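(* $$\sum_{n=1}^{\infty}\frac{1}{n^2}\sum_{k=1}^{n}\binom{n}{k}\frac{(-1)^k x^k}{k^s}=-(s+1)\,Li_{s+2}(x)+\log x\;Li_{s+1}(x).$$
   Context: $Li_s(x)=\sum_{n=1}^{\infty}\frac{x^n}{n^s}$ denotes the polylogarithm. *)

(* Defs.v *)
From Stdlib Require Import Reals.
From Coquelicot Require Import Coquelicot.

Open Scope C_scope.

Definition Cexp (z : C) : C := (exp (Re z) * cos (Im z), exp (Re z) * sin (Im z))%R.

(* Principal argument, with values in (-PI, PI] for z <> 0. *)
Definition Carg (z : C) : R :=
  if Rle_dec 0 (Im z) then acos (Re z / Cmod z) else (- acos (Re z / Cmod z))%R.

Definition Clog (z : C) : C := (ln (Cmod z), Carg z).

(* n ^ s for a positive integer n and a complex exponent s. *)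
Definition npow (n : nat) (s : C) : C := Cexp (s * RtoC (ln (INR n))).

Definition polylog_term (s x : C) (n : nat) : C := x ^ n / npow n s.

(* Li_s(x): the sum over n >= 1, taken componentwise because Coquelicot's total
   operator [Series] is real-valued.  It is meaningful where the series
   converges, in particular for |x| < 1, and for |x| <= 1 when Re s > 1. *)
Definition polylog (s x : C) : C :=
  (Series (fun n => Re (polylog_term s x (S n))),
   Series (fun n => Im (polylog_term s x (S n)))).

(* [Binomial.C] is the real-valued binomial coefficient. *)
Definition inner_sum (s x : C) (n : nat) : C :=
  sum_n_m (fun k => RtoC (Binomial.C n k) * ((-1) ^ k * x ^ k / npow k s)) 1 n.

(* Main.v *)
Require Import Defs.
From Stdlib Require Import Reals.
From Coquelicot Require Import Coquelicot.
From Stdlib Require Import Lra Lia Psatz Factorial.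

Open Scope C_scope.

(** Let [E] be the shift [(E f) z = f (z + 1)].  For a function [f] of [z] put
    [W_N f = (log x) f + f' + sum_(1 <= n <= N) (1 - x E)^n f / n].  Since
    [E (x^z f) = x^z (x E f)], the formal identity
    [d/dz = log E = - sum_n (1 - E)^n / n], conjugated by [x^z], says that
    [W_N f] tends to [0].
    Take [f z = z^-(s+1)], multiply by [x^m] and sum over the integers
    [z = m >= 1].  The first two terms of [W_N] give the right-hand side of the
    theorem, with [f' z = - (s + 1) z^-(s+2)] accounting for the coefficient
    [- (s + 1)].  Each sum over [m] of [x^m (1 - x E)^n f m] telescopes to its
    boundary term [x (1 - x E)^(n-1) f 1], which is [- 1 / n] times the inner
    sum of the theorem because [k binom(n,k) = n binom(n-1,k-1)].  Hence the
    sum over [m] of [x^m W_N f m] is the right-hand side minus the [N]-th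
    partial sum of the left-hand side ([rem_series]).  What remains is analysis:
    [W_N f m] tends to [0], with a bound that allows summation over [m].

    Bounds.  Real powers [z^-q], [q > 0], are completely monotone, and complex
    powers [z^-p] are dominated by a multiple of [z^-(Re p)] in the sense that
    all iterated differences are ([powneg_dominated]).  Writing
    [1 - x E = (1 - E) + (1 - x) E] shows that [(1 - x E)^n z^-p] is dominated
    by the same multiple of [(1 - r E)^n z^-(Re p)] with [r = 1 - |1 - x|], a
    number between [0] and [1] when [|1 - x| <= 1] ([dominates_fdiff]); for
    such [r], the binomial expansion of [1 = ((1 - r E) + r E)^(n+j)] bounds
    [n^j r^j E^j (1 - r E)^n] ([cm_binomial_bound]).

    Vanishing of [W_N].  For [Re p > 0] and [w z = W_N (z^-p)] one has
    [(z^p w)' = p z^(p-1) (1 - x E)^N z^-(p+1)], whose right side tends to [0]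
    as [N] grows; so [z^p w] is asymptotically constant in [z], and letting [z]
    tend to infinity the constant is [log x + sum_n (1 - x)^n / n = 0].  The
    relation [W_N (z g) = z W_N g + (1 - x E)^N g] then extends the result, and the
    bounds, to every complex exponent ([newton_rem_vanish], [newton_rem_poly]).

    This settles the case [|x| < 1], [|1 - x| < 1].  When [Re s > 0] the points
    of the boundary are reached from [r x], [r < 1], by dominated convergence;
    the uniform bound on the terms of the left side is [lhs_term_bound]. *)

(** * Limits and series of complex numbers *)

(* Sums over [C] are typed through the carrier of a canonical structure, which
   [ring] does not recognize as the ring [C]. *)
Ltac Cring := match goal with |- @eq _ ?a ?b => change (@eq C a b) end; ring.

Definition Clim (u : nat -> C) (l : C) : Prop :=
  is_lim_seq (fun n => Cmod (u n - l)) 0%R.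

Notation Cseries := (@is_series C_AbsRing C_NormedModule).

Lemma Clim_eps (u : nat -> C) (l : C) :
  Clim u l <->
  forall eps : posreal, exists N, forall n, (N <= n)%nat -> (Cmod (u n - l) < eps)%R.
Proof.
  unfold Clim; split; intro H.
  - intro eps. apply is_lim_seq_spec in H. destruct (H eps) as [N HN].
    exists N; intros n Hn. specialize (HN n Hn).
    rewrite Rminus_0_r, Rabs_pos_eq in HN by apply Cmod_ge_0. exact HN.
  - apply is_lim_seq_spec; intro eps. destruct (H eps) as [N HN].
    exists N; intros n Hn.
    rewrite Rminus_0_r, Rabs_pos_eq by apply Cmod_ge_0. exact (HN n Hn).
Qed.

Lemma Cseries_Clim (a : nat -> C) (l : C) :
  Cseries a l <-> Clim (sum_n a) l.
Proof.
  rewrite Clim_eps; unfold is_series; split; intro H.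
  - intro eps.
    assert (H' := proj1 (@filterlim_locally_ball_norm C_AbsRing nat C_NormedModule eventually _ (sum_n a) l) H eps).
    destruct H' as [N HN]. exists N; intros n Hn.
    specialize (HN n Hn). exact HN.
  - apply (proj2 (@filterlim_locally_ball_norm C_AbsRing nat C_NormedModule eventually _ (sum_n a) l)).
    intro eps. destruct (H eps) as [N HN]. exists N; intros n Hn.
    exact (HN n Hn).
Qed.

Lemma Clim_squeeze (u : nat -> C) (l : C) (b : nat -> R) :
  (forall n, (Cmod (u n - l) <= b n)%R) -> is_lim_seq b 0%R -> Clim u l.
Proof.
  intros H Hb. apply (is_lim_seq_le_le (fun _ => 0%R) _ b); auto.
  - intro n; split; [apply Cmod_ge_0 | apply H].
  - apply is_lim_seq_const.
Qed.

Lemma Clim_const (c : C) : Clim (fun _ => c) c.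
Proof.
  apply is_lim_seq_ext with (fun _ => 0%R); [|apply is_lim_seq_const].
  intro n. replace (c - c) with (RtoC 0) by ring. now rewrite Cmod_0.
Qed.

Lemma Clim_ext (u v : nat -> C) (l : C) :
  (forall n, u n = v n) -> Clim u l -> Clim v l.
Proof. intros H; apply is_lim_seq_ext; intro n; now rewrite H. Qed.

Lemma Clim_plus (u v : nat -> C) (l m : C) :
  Clim u l -> Clim v m -> Clim (fun n => u n + v n) (l + m).
Proof.
  intros Hu Hv.
  apply Clim_squeeze with (fun n => (Cmod (u n - l) + Cmod (v n - m))%R).
  - intro n. replace (u n + v n - (l + m)) with ((u n - l) + (v n - m)) by ring.
    apply Cmod_triangle.
  - replace 0%R with (0 + 0)%R by ring. now apply is_lim_seq_plus'.
Qed.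

Lemma Clim_scal (c : C) (u : nat -> C) (l : C) :
  Clim u l -> Clim (fun n => c * u n) (c * l).
Proof.
  intros Hu. apply Clim_squeeze with (fun n => (Cmod c * Cmod (u n - l))%R).
  - intro n. replace (c * u n - c * l) with (c * (u n - l)) by ring.
    rewrite Cmod_mult; apply Rle_refl.
  - replace 0%R with (Cmod c * 0)%R by ring. now apply is_lim_seq_mult'; [apply is_lim_seq_const|].
Qed.

Lemma Clim_mod (u : nat -> C) (l : C) :
  Clim u l -> is_lim_seq (fun n => Cmod (u n)) (Cmod l).
Proof.
  intros Hu.
  apply is_lim_seq_le_le with (fun n => (Cmod l - Cmod (u n - l))%R)
                              (fun n => (Cmod l + Cmod (u n - l))%R).
  - intro n; split.
    + assert (H := Cmod_triangle (u n) (- (u n - l))).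
      replace (u n + - (u n - l)) with l in H by ring. rewrite Cmod_opp in H. lra.
    + assert (H := Cmod_triangle l (u n - l)).
      replace (l + (u n - l)) with (u n) in H by ring. lra.
  - replace (Finite (Cmod l)) with (Finite (Cmod l - 0)) by (f_equal; ring).
    apply is_lim_seq_minus'; [apply is_lim_seq_const | exact Hu].
  - replace (Finite (Cmod l)) with (Finite (Cmod l + 0)) by (f_equal; ring).
    apply is_lim_seq_plus'; [apply is_lim_seq_const | exact Hu].
Qed.

Lemma Clim_mult (u v : nat -> C) (l m : C) :
  Clim u l -> Clim v m -> Clim (fun n => u n * v n) (l * m).
Proof.
  intros Hu Hv.
  apply Clim_squeeze with (fun n => (Cmod (u n) * Cmod (v n - m) + Cmod m * Cmod (u n - l))%R).
  - intro n. replace (u n * v n - l * m) with (u n * (v n - m) + m * (u n - l)) by ring.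
    eapply Rle_trans; [apply Cmod_triangle|]. rewrite !Cmod_mult; lra.
  - replace 0%R with (Cmod l * 0 + Cmod m * 0)%R by ring.
    apply is_lim_seq_plus'; apply is_lim_seq_mult'; auto using Clim_mod.
    apply is_lim_seq_const.
Qed.

Lemma Clim_unique (u : nat -> C) (l m : C) : Clim u l -> Clim u m -> l = m.
Proof.
  intros Hl Hm. apply Ceq_minus. apply Cmod_eq_0.
  assert (H : Clim (fun n => u n + -1 * u n) (m + -1 * l)).
  { apply Clim_plus; auto. now apply Clim_scal. }
  apply Clim_mod in H.
  apply is_lim_seq_ext with (v := fun _ => 0%R) in H.
  2:{ intro n. replace (u n + -1 * u n) with (RtoC 0) by ring. apply Cmod_0. }
  assert (H0 := is_lim_seq_unique _ _ H). rewrite Lim_seq_const in H0.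
  injection H0 as H0. rewrite H0.
  rewrite <- Cmod_opp. f_equal. ring.
Qed.

Lemma Clim_le (u : nat -> C) (l : C) (b : R) :
  (forall n, (Cmod (u n) <= b)%R) -> Clim u l -> (Cmod l <= b)%R.
Proof.
  intros Hb Hu. apply Clim_mod in Hu.
  apply (is_lim_seq_le _ _ _ _ Hb Hu (is_lim_seq_const b)).
Qed.

Lemma sum_n_C_S (a : nat -> C) (n : nat) : sum_n a (S n) = sum_n a n + a (S n).
Proof. exact (sum_Sn a n). Qed.

Lemma sum_n_R_S (a : nat -> R) (n : nat) : sum_n a (S n) = (sum_n a n + a (S n))%R.
Proof. exact (sum_Sn a n). Qed.

Lemma Cmod_sum_n_le (a : nat -> C) (g : nat -> R) (n : nat) :
  (forall k, (Cmod (a k) <= g k)%R) -> (Cmod (sum_n a n) <= sum_n g n)%R.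
Proof.
  intro H. induction n.
  - rewrite !sum_O. apply H.
  - rewrite sum_n_C_S, sum_n_R_S. eapply Rle_trans; [apply Cmod_triangle|].
    apply Rplus_le_compat; [exact IHn | apply H].
Qed.

Lemma Cseries_pair (a : nat -> C) (x y : R) :
  is_series (fun k => Re (a k)) x -> is_series (fun k => Im (a k)) y -> Cseries a (x, y).
Proof.
  intros Hx Hy. apply Cseries_Clim.
  assert (Hs : forall n, sum_n a n =
    (sum_n (fun k => Re (a k)) n, sum_n (fun k => Im (a k)) n)).
  { induction n.
    - rewrite !sum_O. now destruct (a 0%nat).
    - rewrite sum_n_C_S, IHn, !sum_Sn. now destruct (a (S n)). }
  apply Clim_squeeze with (fun n => (Rabs (sum_n (fun k => Re (a k)) n - x) +
     Rabs (sum_n (fun k => Im (a k)) n - y))%R).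
  - intro n. rewrite Hs.
    set (p := sum_n (fun k => Re (a k)) n). set (q := sum_n (fun k => Im (a k)) n).
    replace ((p, q) - (x, y)) with (RtoC (p - x) + Ci * RtoC (q - y)).
    2:{ unfold RtoC, Ci, Cplus, Cminus, Cmult, Copp, Cplus; simpl; f_equal; ring. }
    eapply Rle_trans; [apply Cmod_triangle|].
    rewrite Cmod_mult, Cmod_Ci, !Cmod_R; lra.
  - replace 0%R with (Rabs (x - x) + Rabs (y - y))%R by (rewrite !Rminus_diag, Rabs_R0; ring).
    apply is_lim_seq_plus'; apply is_lim_seq_abs with (l := Finite (_ - _));
      apply is_lim_seq_minus'; auto; apply is_lim_seq_const.
Qed.

Lemma Cseries_dominated (a : nat -> C) (g : nat -> R) :
  (forall k, (Cmod (a k) <= g k)%R) -> ex_series g ->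
  Cseries a (Series (fun k => Re (a k)), Series (fun k => Im (a k))).
Proof.
  intros H Hg.
  apply Cseries_pair; apply Series_correct;
    apply (@ex_series_le R_AbsRing R_CompleteNormedModule _ g); auto;
    intro n; (eapply Rle_trans; [|apply H]).
  - apply re_le_Cmod.
  - change (norm (Im (a n))) with (Rabs (Im (a n))).
    eapply Rle_trans; [apply Rmax_r | apply Rmax_Cmod].
Qed.

Lemma Cseries_tail (a : nat -> C) (g : nat -> R) (l : C) (M : nat) :
  (forall k, (Cmod (a k) <= g k)%R) -> ex_series g -> Cseries a l ->
  (Cmod (l - sum_n a M) <= Series g - sum_n g M)%R.
Proof.
  intros H Hg Ha. apply Cseries_Clim in Ha.
  assert (Hg0 : forall k, (0 <= g k)%R) by (intro k; eapply Rle_trans; [apply Cmod_ge_0 | apply H]).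
  assert (Hinc : forall n, (Cmod (sum_n a (M + n) - sum_n a M) <= sum_n g (M + n) - sum_n g M)%R).
  { induction n.
    - rewrite Nat.add_0_r. replace (sum_n a M - sum_n a M) with (RtoC 0) by ring. rewrite Cmod_0. lra.
    - rewrite Nat.add_succ_r, sum_n_C_S, sum_n_R_S.
      replace (sum_n a (M + n) + a (S (M + n)) - sum_n a M)
        with ((sum_n a (M + n) - sum_n a M) + a (S (M + n))) by ring.
      eapply Rle_trans; [apply Cmod_triangle|].
      specialize (H (S (M + n))). lra. }
  assert (Hle : forall n, (sum_n g n <= Series g)%R).
  { intro n. apply Series_correct in Hg.
    apply (is_lim_seq_incr_compare (sum_n g)); [exact Hg|].
    intro k. rewrite sum_n_R_S. specialize (Hg0 (S k)). lra. }
  apply Clim_le with (fun n => sum_n a (n + M) + - sum_n a M).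
  - intro n. specialize (Hinc n). rewrite (Nat.add_comm M n) in Hinc. specialize (Hle (n + M)%nat).
    change (sum_n a (n + M) + - sum_n a M) with (sum_n a (n + M) - sum_n a M). lra.
  - apply Clim_plus; [|apply Clim_const].
    exact (proj1 (is_lim_seq_incr_n (fun n => Cmod (sum_n a n - l)) M (Finite 0)) Ha).
Qed.

Lemma Clim_sum_n (f : nat -> nat -> C) (f0 : nat -> C) (n : nat) :
  (forall k, Clim (fun i => f i k) (f0 k)) ->
  Clim (fun i => sum_n (f i) n) (sum_n f0 n).
Proof.
  intro H. induction n.
  - rewrite sum_O. apply Clim_ext with (fun i => f i 0%nat); auto.
    intro i; now rewrite sum_O.
  - rewrite sum_n_C_S. apply Clim_ext with (fun i => sum_n (f i) n + f i (S n)).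
    + intro i; now rewrite sum_n_C_S.
    + now apply Clim_plus.
Qed.

(** Dominated convergence for series: the tails are small uniformly in [i], and
    the partial sums converge termwise.  The limit series is only asserted to
    have some sum, which the applications identify by other means. *)
Lemma tannery (f : nat -> nat -> C) (f0 : nat -> C) (L : nat -> C) (g : nat -> R) :
  (forall i k, (Cmod (f i k) <= g k)%R) -> ex_series g ->
  (forall i, Cseries (f i) (L i)) ->
  (forall k, Clim (fun i => f i k) (f0 k)) ->
  exists l, Cseries f0 l /\ Clim L l.
Proof.
  intros Hdom Hg HL Hf.
  assert (Hdom0 : forall k, (Cmod (f0 k) <= g k)%R).
  { intro k. apply Clim_le with (fun i => f i k); auto. }
  set (l := (Series (fun k => Re (f0 k)), Series (fun k => Im (f0 k))) : C).
  assert (Hl : Cseries f0 l) by (now apply Cseries_dominated with g).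
  exists l; split; [exact Hl|].
  apply Clim_eps; intro eps.
  assert (Hg' : is_lim_seq (sum_n g) (Series g)) by (apply Series_correct; exact Hg).
  apply is_lim_seq_spec in Hg'.
  assert (He : (0 < eps / 4)%R) by (destruct eps; simpl; lra).
  destruct (Hg' (mkposreal _ He)) as [M HM]. specialize (HM M (le_n M)). simpl in HM.
  assert (HS := Clim_sum_n f f0 M Hf). rewrite Clim_eps in HS.
  destruct (HS (mkposreal _ He)) as [N HN]. exists N; intros n Hn. specialize (HN n Hn); simpl in HN.
  assert (T1 := Cseries_tail _ g _ M (Hdom n) Hg (HL n)).
  assert (T2 := Cseries_tail _ g _ M Hdom0 Hg Hl).
  assert (T : (Series g - sum_n g M < eps / 4)%R).
  { rewrite Rabs_minus_sym in HM. eapply Rle_lt_trans; [apply Rle_abs | exact HM]. }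
  replace (L n - l) with ((L n - sum_n (f n) M) + ((sum_n (f n) M - sum_n f0 M) + - (l - sum_n f0 M))) by ring.
  eapply Rle_lt_trans; [apply Cmod_triangle|].
  assert (T3 := Cmod_triangle (sum_n (f n) M - sum_n f0 M) (- (l - sum_n f0 M))).
  rewrite Cmod_opp in T3. lra.
Qed.

(** * Differentiation of complex functions of a real variable *)

Definition derivC (f : R -> C) (t : R) (l : C) : Prop :=
  is_derive (fun u => Re (f u)) t (Re l) /\ is_derive (fun u => Im (f u)) t (Im l).

Lemma derivC_ext (f g : R -> C) (t : R) (l : C) :
  (forall u, f u = g u) -> derivC f t l -> derivC g t l.
Proof.
  intros E [H1 H2]; split; [apply is_derive_ext with (2 := H1) | apply is_derive_ext with (2 := H2)];
    intro u; now rewrite E.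
Qed.

Lemma derivC_const (c : C) (t : R) : derivC (fun _ => c) t 0.
Proof. split; apply (is_derive_const (K := R_AbsRing) (V := R_NormedModule)). Qed.

Lemma derivC_plus (f g : R -> C) (t : R) (a b : C) :
  derivC f t a -> derivC g t b -> derivC (fun u => f u + g u) t (a + b).
Proof.
  intros [H1 H2] [H3 H4]; split.
  - exact (is_derive_plus _ _ _ _ _ H1 H3).
  - exact (is_derive_plus _ _ _ _ _ H2 H4).
Qed.

Lemma derivC_mult (f g : R -> C) (t : R) (a b : C) :
  derivC f t a -> derivC g t b -> derivC (fun u => f u * g u) t (a * g t + f t * b).
Proof.
  intros [H1 H2] [H3 H4]; split.
  - evar_last.
    { apply (is_derive_minus (K := R_AbsRing) (V := R_NormedModule)).
      - apply (is_derive_mult (fun u => Re (f u)) (fun u => Re (g u))); [exact H1 | exact H3 | apply Rmult_comm].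
      - apply (is_derive_mult (fun u => Im (f u)) (fun u => Im (g u))); [exact H2 | exact H4 | apply Rmult_comm]. }
    unfold minus, plus, opp, mult, Re, Im, Cplus, Cmult; simpl. ring.
  - evar_last.
    { apply (is_derive_plus (K := R_AbsRing) (V := R_NormedModule)).
      - apply (is_derive_mult (fun u => Re (f u)) (fun u => Im (g u))); [exact H1 | exact H4 | apply Rmult_comm].
      - apply (is_derive_mult (fun u => Im (f u)) (fun u => Re (g u))); [exact H2 | exact H3 | apply Rmult_comm]. }
    unfold minus, plus, opp, mult, Re, Im, Cplus, Cmult; simpl. ring.
Qed.

Lemma derivC_scal (c : C) (f : R -> C) (t : R) (a : C) :
  derivC f t a -> derivC (fun u => c * f u) t (c * a).
Proof.
  intro H. replace (c * a) with (0 * f t + c * a) by ring.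
  apply (derivC_mult (fun _ => c)); [apply derivC_const | exact H].
Qed.

Lemma derivC_shift (f : R -> C) (t h : R) (a : C) :
  derivC f (t + h)%R a -> derivC (fun u => f (u + h)%R) t a.
Proof.
  intros [H1 H2]; split.
  - evar_last. { apply (is_derive_comp (fun u => Re (f u)) (fun u => (u + h)%R)).
      - exact H1.
      - auto_derive; [trivial | reflexivity]. }
    unfold scal; simpl; unfold mult; simpl; ring.
  - evar_last. { apply (is_derive_comp (fun u => Im (f u)) (fun u => (u + h)%R)).
      - exact H2.
      - auto_derive; [trivial | reflexivity]. }
    unfold scal; simpl; unfold mult; simpl; ring.
Qed.

Lemma derivC_sum_n (f : nat -> R -> C) (a : nat -> C) (t : R) (n : nat) :
  (forall k, derivC (f k) t (a k)) ->
  derivC (fun u => sum_n (fun k => f k u) n) t (sum_n a n).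
Proof.
  intro H. induction n.
  - rewrite sum_O. refine (derivC_ext _ _ _ _ _ (H 0%nat)). intro u. now rewrite sum_O.
  - rewrite sum_n_C_S. refine (derivC_ext _ _ _ _ _ (derivC_plus _ _ _ _ _ IHn (H (S n)))).
    intro u. now rewrite sum_n_C_S.
Qed.

Lemma is_derive_nonneg_incr (f df : R -> R) (a b : R) :
  (a <= b)%R -> (forall t, (a <= t <= b)%R -> is_derive f t (df t)) ->
  (forall t, (a <= t <= b)%R -> (0 <= df t)%R) -> (f a <= f b)%R.
Proof.
  intros Hab Hd Hpos.
  destruct (MVT_gen f a b df) as [c [Hc E]].
  - rewrite Rmin_left, Rmax_right by exact Hab. intros t Ht; apply Hd; lra.
  - rewrite Rmin_left, Rmax_right by exact Hab. intros t Ht.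
    apply continuity_pt_filterlim. apply (ex_derive_continuous (V := R_NormedModule)).
    exists (df t). now apply Hd.
  - rewrite Rmin_left, Rmax_right in Hc by exact Hab.
    specialize (Hpos c Hc). nra.
Qed.

(** There is no mean value equality for complex values; projecting onto the
    direction of [d = f a - f b] reduces the claim to monotonicity of the real
    function [Re (conj d * f) - |d| g]. *)
Lemma mean_value_dominated (f f' : R -> C) (g g' : R -> R) (a b : R) :
  (a <= b)%R ->
  (forall t, (a <= t <= b)%R -> derivC f t (f' t)) ->
  (forall t, (a <= t <= b)%R -> is_derive g t (- g' t)%R) ->
  (forall t, (a <= t <= b)%R -> (Cmod (f' t) <= g' t)%R) ->
  (Cmod (f a - f b) <= g a - g b)%R.
Proof.
  intros Hab Hf Hg Hle.
  assert (Hg' : (- g a <= - g b)%R).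
  { apply (is_derive_nonneg_incr (fun t => - g t)%R g' a b Hab).
    - intros t Ht. rewrite <- (Ropp_involutive (g' t)).
      apply (is_derive_opp (K := R_AbsRing) (V := R_NormedModule)). now apply Hg.
    - intros t Ht. eapply Rle_trans; [apply Cmod_ge_0 | now apply Hle]. }
  set (d := f a - f b).
  destruct (Req_dec (Cmod d) 0) as [E|E]; [lra|].
  assert (Hd : (0 < Cmod d)%R) by (assert (H := Cmod_ge_0 d); lra).
  assert (H := is_derive_nonneg_incr
    (fun t => Re d * Re (f t) + Im d * Im (f t) + - Cmod d * g t)%R
    (fun t => Re d * Re (f' t) + Im d * Im (f' t) + - Cmod d * - g' t)%R a b Hab).
  assert (E2 := Cmod2_alt d).
  assert (Er : Re d = (Re (f a) - Re (f b))%R) by reflexivity.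
  assert (Ei : Im d = (Im (f a) - Im (f b))%R) by reflexivity.
  cut (Cmod d ^ 2 <= Cmod d * (g a - g b))%R; [nra|].
  rewrite E2. rewrite Er at 1. rewrite Ei at 1.
  enough (Re d * Re (f a) + Im d * Im (f a) + - Cmod d * g a <=
      Re d * Re (f b) + Im d * Im (f b) + - Cmod d * g b)%R by nra.
  apply H.
  - intros t Ht. destruct (Hf t Ht) as [H1 H2]. specialize (Hg t Ht).
    apply (is_derive_plus (K := R_AbsRing) (V := R_NormedModule));
      [apply (is_derive_plus (K := R_AbsRing) (V := R_NormedModule))|];
      now apply (is_derive_scal (fun u => _)).
  - intros t Ht. specialize (Hle t Ht).
    assert (Hc : (- (Cmod d * Cmod (f' t)) <= Re d * Re (f' t) + Im d * Im (f' t))%R).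
    { assert (R1 := re_le_Cmod (Cconj d * f' t)). rewrite Cmod_mult, Cmod_conj in R1.
      replace (Re (Cconj d * f' t)) with (Re d * Re (f' t) + Im d * Im (f' t))%R in R1
        by (unfold Re, Im, Cconj, Cmult; simpl; ring).
      assert (R2 := Rabs_maj2 (Re d * Re (f' t) + Im d * Im (f' t))). lra. }
    nra.
Qed.

Lemma mean_value_bound (f f' : R -> C) (M a b : R) :
  (a <= b)%R ->
  (forall t, (a <= t <= b)%R -> derivC f t (f' t)) ->
  (forall t, (a <= t <= b)%R -> (Cmod (f' t) <= M)%R) ->
  (Cmod (f a - f b) <= M * (b - a))%R.
Proof.
  intros Hab Hf HM.
  replace (M * (b - a))%R with (- M * a - - M * b)%R by ring.
  apply (mean_value_dominated f f' (fun t => - M * t)%R (fun _ => M)); auto.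
  intros t _. auto_derive; [trivial | ring].
Qed.

(** * Complex powers of a positive real variable *)

Definition powneg (p : C) (z : R) : C := Cexp (- p * RtoC (ln z)).

Definition rpowneg (q z : R) : R := exp (- q * ln z).

Lemma Cexp_plus (a b : C) : Cexp (a + b) = Cexp a * Cexp b.
Proof.
  unfold Cexp, Cmult; simpl.
  rewrite exp_plus, cos_plus, sin_plus. unfold Re, Im; f_equal; ring.
Qed.

Lemma Cexp_0 : Cexp 0 = 1.
Proof. unfold Cexp, RtoC, Re, Im; simpl. rewrite exp_0, cos_0, sin_0. f_equal; ring. Qed.

Lemma Cmod_Cexp (z : C) : Cmod (Cexp z) = exp (Re z).
Proof.
  unfold Cmod, Cexp; simpl.
  replace (_ + _)%R with (exp (Re z) * exp (Re z) * (Rsqr (sin (Im z)) + Rsqr (cos (Im z))))%R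
    by (unfold Rsqr; ring).
  rewrite sin2_cos2, Rmult_1_r. apply sqrt_square. apply Rlt_le, exp_pos.
Qed.

Lemma Cmod_powneg (p : C) (z : R) : Cmod (powneg p z) = rpowneg (Re p) z.
Proof.
  unfold powneg, rpowneg. rewrite Cmod_Cexp, re_scal_r. reflexivity.
Qed.

Lemma rpowneg_pos (q z : R) : (0 < rpowneg q z)%R.
Proof. apply exp_pos. Qed.

Lemma powneg_plus (p q : C) (z : R) : powneg (p + q) z = powneg p z * powneg q z.
Proof. unfold powneg. rewrite <- Cexp_plus. f_equal. ring. Qed.

Lemma rpowneg_plus (p q z : R) : rpowneg (p + q) z = (rpowneg p z * rpowneg q z)%R.
Proof. unfold rpowneg. rewrite <- exp_plus. f_equal. ring. Qed.

Lemma powneg_0 (z : R) : powneg 0 z = 1.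
Proof. unfold powneg. rewrite <- Cexp_0. f_equal. ring. Qed.

Lemma rpowneg_0 (z : R) : rpowneg 0 z = 1%R.
Proof. unfold rpowneg. rewrite <- exp_0. f_equal. ring. Qed.

Lemma powneg_opp (p : C) (z : R) : powneg (- p) z * powneg p z = 1.
Proof. rewrite <- powneg_plus, <- (powneg_0 z). f_equal. ring. Qed.

Lemma powneg_m1 (z : R) : (0 < z)%R -> powneg (- (1)) z = RtoC z.
Proof.
  intro Hz. unfold powneg.
  replace (- - (1) * RtoC (ln z)) with (RtoC (ln z)) by ring.
  unfold Cexp; simpl. rewrite cos_0, sin_0, exp_ln by exact Hz.
  unfold RtoC; f_equal; ring.
Qed.

Lemma powneg_succ (p : C) (z : R) : (0 < z)%R -> powneg p z = z * powneg (p + 1) z.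
Proof.
  intro Hz. rewrite <- (powneg_m1 z Hz), <- powneg_plus. f_equal. ring.
Qed.

Lemma rpowneg_succ (q z : R) : (0 < z)%R -> rpowneg q z = (z * rpowneg (q + 1) z)%R.
Proof.
  intro Hz. rewrite rpowneg_plus. unfold rpowneg at 3. 
  replace (- (1) * ln z)%R with (- ln z)%R by ring.
  rewrite exp_Ropp, exp_ln by exact Hz. field. lra.
Qed.

Lemma exp_mono (a b : R) : (a <= b)%R -> (exp a <= exp b)%R.
Proof.
  intros [H|H]; [now apply Rlt_le, exp_increasing | rewrite H; apply Rle_refl].
Qed.

Lemma rpowneg_decr (q y z : R) : (0 <= q)%R -> (0 < y <= z)%R -> (rpowneg q z <= rpowneg q y)%R.
Proof.
  intros Hq [Hy Hyz]. unfold rpowneg.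
  assert (H : (ln y <= ln z)%R) by (now apply ln_le).
  apply exp_mono. nra.
Qed.

Lemma rpowneg_le_1 (q z : R) : (0 <= q)%R -> (1 <= z)%R -> (rpowneg q z <= 1)%R.
Proof.
  intros Hq Hz. replace 1%R with (rpowneg q 1) at 1.
  - apply rpowneg_decr; lra.
  - unfold rpowneg. rewrite ln_1, Rmult_0_r. apply exp_0.
Qed.

Lemma derivC_powneg (p : C) (z : R) :
  (0 < z)%R -> derivC (powneg p) z (- p * powneg (p + 1) z).
Proof.
  intro Hz.
  assert (E : powneg (p + 1) z = powneg p z * RtoC (/ z)).
  { rewrite (powneg_succ p z Hz), RtoC_inv by lra. field. intro H. apply RtoC_inj in H; lra. }
  rewrite E. clear E.
  assert (HR : forall t, Re (powneg p t) = (exp (- Re p * ln t) * cos (- Im p * ln t))%R).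
  { intro t. unfold powneg, Cexp, Re, Im; simpl. f_equal; f_equal; ring. }
  assert (HI : forall t, Im (powneg p t) = (exp (- Re p * ln t) * sin (- Im p * ln t))%R).
  { intro t. unfold powneg, Cexp, Re, Im; simpl. f_equal; f_equal; ring. }
  assert (HRe : Re (- p * (powneg p z * RtoC (/ z))) = (/ z * (- Re p * Re (powneg p z) + Im p * Im (powneg p z)))%R).
  { unfold Re, Im, Cmult, Copp; simpl; ring. }
  assert (HIm : Im (- p * (powneg p z * RtoC (/ z))) = (/ z * (- Re p * Im (powneg p z) - Im p * Re (powneg p z)))%R).
  { unfold Re, Im, Cmult, Copp; simpl; ring. }
  split.
  - rewrite HRe, HR, HI.
    apply is_derive_ext with (fun t => (exp (- Re p * ln t) * cos (- Im p * ln t))%R).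
    { intro t; now rewrite HR. }
    auto_derive; [lra | field; lra].
  - rewrite HIm, HR, HI.
    apply is_derive_ext with (fun t => (exp (- Re p * ln t) * sin (- Im p * ln t))%R).
    { intro t; now rewrite HI. }
    auto_derive; [lra | field; lra].
Qed.

Lemma is_derive_rpowneg (q z : R) :
  (0 < z)%R -> is_derive (rpowneg q) z (- (q * rpowneg (q + 1) z))%R.
Proof.
  intro Hz. unfold rpowneg at 1. auto_derive; [lra|].
  fold (rpowneg q z). rewrite (rpowneg_succ q z Hz). field. lra.
Qed.

(** * Weighted differences and complete monotonicity *)

(** The operator [(1 - x E)^n], where [E] is the unit shift. *)
Fixpoint fdiff (x : C) (n : nat) (f : R -> C) (z : R) : C :=
  match n with
  | O => f z
  | S n => fdiff x n f z - x * fdiff x n f (z + 1)%R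
  end.

Fixpoint rdiff (r : R) (n : nat) (g : R -> R) (z : R) : R :=
  match n with
  | O => g z
  | S n => (rdiff r n g z - r * rdiff r n g (z + 1))%R
  end.

Lemma fdiff_S (x : C) (n : nat) (f : R -> C) (z : R) :
  fdiff x (S n) f z = fdiff x n f z - x * fdiff x n f (z + 1)%R.
Proof. reflexivity. Qed.

Lemma fdiff_ext (x : C) (n : nat) (f f' : R -> C) (z : R) :
  (forall k, f (z + INR k)%R = f' (z + INR k)%R) -> fdiff x n f z = fdiff x n f' z.
Proof.
  revert z. induction n; intros z H; simpl.
  - specialize (H 0%nat). simpl in H. now rewrite Rplus_0_r in H.
  - rewrite (IHn z), (IHn (z + 1)%R); auto.
    intro k. specialize (H (S k)). rewrite S_INR in H.
    replace (z + 1 + INR k)%R with (z + (INR k + 1))%R by ring. exact H.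
Qed.

Lemma fdiff_ext_pos (x : C) (n : nat) (f f' : R -> C) (z : R) :
  (0 < z)%R -> (forall y, (0 < y)%R -> f y = f' y) -> fdiff x n f z = fdiff x n f' z.
Proof.
  intros Hz H. apply fdiff_ext. intro k. apply H. assert (Hk := pos_INR k). lra.
Qed.

Lemma fdiff_scal (x c : C) (n : nat) (f : R -> C) (z : R) :
  fdiff x n (fun y => c * f y) z = c * fdiff x n f z.
Proof. revert z. induction n; intro z; simpl; [reflexivity|]. rewrite !IHn; ring. Qed.

Lemma rdiff_scal (r c : R) (n : nat) (g : R -> R) (z : R) :
  rdiff r n (fun y => c * g y)%R z = (c * rdiff r n g z)%R.
Proof. revert z. induction n; intro z; simpl; [reflexivity|]. rewrite !IHn; ring. Qed.

Lemma rdiff_shift (r : R) (n : nat) (g : R -> R) (z : R) :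
  rdiff r n (fun y => g (y + 1)%R) z = rdiff r n g (z + 1)%R.
Proof. revert z. induction n; intro z; simpl; [reflexivity|]. now rewrite !IHn. Qed.

Lemma fdiff_step (x y : C) (n : nat) (f : R -> C) (z : R) :
  fdiff x n (fdiff y 1 f) z = fdiff x n f z - y * fdiff x n f (z + 1)%R.
Proof. revert z. induction n; intro z; simpl; [reflexivity|]. rewrite !IHn; ring. Qed.

Lemma rdiff_step (r q : R) (n : nat) (g : R -> R) (z : R) :
  rdiff r n (rdiff q 1 g) z = (rdiff r n g z - q * rdiff r n g (z + 1))%R.
Proof. revert z. induction n; intro z; simpl; [reflexivity|]. rewrite !IHn; ring. Qed.

Lemma derivC_fdiff (x : C) (n : nat) (f f' : R -> C) (z : R) :
  (0 < z)%R -> (forall y, (0 < y)%R -> derivC f y (f' y)) ->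
  derivC (fdiff x n f) z (fdiff x n f' z).
Proof.
  revert z. induction n; intros z Hz H; simpl; [now apply H|].
  replace (fdiff x n f' z - x * fdiff x n f' (z + 1)%R)
    with (fdiff x n f' z + (- x) * fdiff x n f' (z + 1)%R) by ring.
  assert (E : derivC (fun u => fdiff x n f u + - x * fdiff x n f (u + 1)%R) z
     (fdiff x n f' z + - x * fdiff x n f' (z + 1)%R)).
  { apply derivC_plus; [now apply IHn|]. apply derivC_scal.
    apply derivC_shift. apply IHn; [lra | exact H]. }
  refine (derivC_ext _ _ _ _ _ E). intro u. simpl. ring.
Qed.

Lemma is_derive_rdiff (r : R) (n : nat) (g g' : R -> R) (z : R) :
  (0 < z)%R -> (forall y, (0 < y)%R -> is_derive g y (g' y)) ->
  is_derive (rdiff r n g) z (rdiff r n g' z).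
Proof.
  revert z. induction n; intros z Hz H; simpl; [now apply H|].
  apply (is_derive_minus (K := R_AbsRing) (V := R_NormedModule)); [now apply IHn|].
  apply (is_derive_scal (fun u => rdiff r n g (u + 1)%R)).
  evar_last.
  { apply (is_derive_comp (rdiff r n g) (fun u => (u + 1)%R)).
    - apply IHn; [lra | exact H].
    - auto_derive; [trivial | reflexivity]. }
  unfold scal; simpl; unfold mult; simpl; ring.
Qed.

(** The commutator of [E] with multiplication by [z] is [E], hence that of
    [(1 - x E)^n] is [- n x E (1 - x E)^(n-1)].  This relation lowers the
    exponent [p] of [z^-p] by one. *)
Lemma fdiff_mul_id (x : C) (n : nat) (g : R -> C) (z : R) :
  fdiff x (S n) (fun y => RtoC y * g y) z
  = z * fdiff x (S n) g z - RtoC (INR (S n)) * x * fdiff x n g (z + 1)%R.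
Proof.
  revert z. induction n; intro z.
  - simpl. rewrite RtoC_plus. ring.
  - change (fdiff x (S (S n)) (fun y => RtoC y * g y) z) with
      (fdiff x (S n) (fun y => RtoC y * g y) z - x * fdiff x (S n) (fun y => RtoC y * g y) (z + 1)%R).
    rewrite (IHn z), (IHn (z + 1)%R). rewrite (S_INR (S n)), !RtoC_plus.
    simpl fdiff. ring.
Qed.

Definition completely_monotone (g : R -> R) : Prop :=
  forall j z, (0 < z)%R -> (0 <= rdiff 1 j g z)%R.

(** Morally: [f] and [g] are Laplace transforms, and the measure of [g] bounds
    the absolute value of the measure of [f].  Stating this through differences
    avoids integrals, and the Gamma function in particular. *)
Definition dominates (g : R -> R) (f : R -> C) : Prop :=
  forall j z, (0 < z)%R -> (Cmod (fdiff 1 j f z) <= rdiff 1 j g z)%R.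

Lemma dominates_cm (g : R -> R) (f : R -> C) : dominates g f -> completely_monotone g.
Proof. intros H j z Hz. eapply Rle_trans; [apply Cmod_ge_0 | now apply H]. Qed.

(** The splitting [1 - x E = (1 - E) + (1 - x) E] has the right signs: replacing
    [1 - x] by its modulus gives [1 - r E] with [r = 1 - |1 - x|].  Splitting
    instead into [(1 - x) + x (1 - E)] would lead to [(|1 - x| + |x| (1 - E))^n],
    which grows with [n] for non-real [x], as [|1 - x| + |x|] exceeds [1]. *)
Lemma dominates_step (x : C) (g : R -> R) (f : R -> C) :
  dominates g f -> dominates (rdiff (1 - Cmod (1 - x)) 1 g) (fdiff x 1 f).
Proof.
  intros H j z Hz. rewrite fdiff_step, rdiff_step.
  replace (fdiff 1 j f z - x * fdiff 1 j f (z + 1)%R)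
    with (fdiff 1 (S j) f z + (1 - x) * fdiff 1 j f (z + 1)%R) by (simpl; ring).
  eapply Rle_trans; [apply Cmod_triangle|]. rewrite Cmod_mult.
  assert (H1 := H (S j) z Hz). assert (H2 := H j (z + 1)%R ltac:(lra)).
  assert (H3 := Cmod_ge_0 (1 - x)). simpl rdiff in H1 |- *. nra.
Qed.

Lemma dominates_fdiff (x : C) (n : nat) (g : R -> R) (f : R -> C) :
  dominates g f -> dominates (rdiff (1 - Cmod (1 - x)) n g) (fdiff x n f).
Proof.
  intro H. induction n; [exact H|].
  exact (dominates_step x _ _ IHn).
Qed.

Lemma cm_step (r : R) (g : R -> R) :
  (0 <= r <= 1)%R -> completely_monotone g -> completely_monotone (rdiff r 1 g).
Proof.
  intros Hr H j z Hz. rewrite rdiff_step.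
  assert (H1 := H (S j) z Hz). assert (H2 := H j (z + 1)%R ltac:(lra)).
  simpl in H1. nra.
Qed.

Lemma cm_shift (g : R -> R) :
  completely_monotone g -> completely_monotone (fun y => g (y + 1)%R).
Proof. intros H j z Hz. rewrite rdiff_shift. apply H; lra. Qed.

(** The product [(n + 1) ... (n + j)]; divided by [j!] it is the binomial
    coefficient of [n + j] over [j]. *)
Fixpoint rising (n j : nat) : R :=
  match j with
  | O => 1
  | S j => rising n j * INR (n + S j)
  end.

Lemma rising_pos (n j : nat) : (0 < rising n j)%R.
Proof.
  induction j; simpl; [lra|]. apply Rmult_lt_0_compat; [exact IHj|].
  apply lt_0_INR; lia.
Qed.

Lemma rising_shift (n j : nat) : (INR (S n) * rising (S n) j = rising n (S j))%R.
Proof.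
  induction j.
  - simpl rising. replace (n + 1)%nat with (S n) by lia. ring.
  - change (rising (S n) (S j)) with (rising (S n) j * INR (S n + S j))%R.
    change (rising n (S (S j))) with (rising n (S j) * INR (n + S (S j)))%R.
    rewrite <- IHj. replace (S n + S j)%nat with (n + S (S j))%nat by lia. ring.
Qed.

Lemma rising_pascal (n j : nat) :
  (rising (S n) (S j) = rising n (S j) + INR (S j) * rising (S n) j)%R.
Proof.
  rewrite <- (rising_shift n j). change (rising (S n) (S j)) with (rising (S n) j * INR (S n + S j))%R.
  rewrite plus_INR. ring.
Qed.

Lemma rising_0 (j : nat) : rising 0 j = INR (fact j).
Proof.
  induction j; [reflexivity|].
  change (rising 0 (S j)) with (rising 0 j * INR (S j))%R.
  rewrite IHj, fact_simpl, mult_INR. ring.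
Qed.

(** The left side, divided by [j!], is one term of the binomial expansion of
    [((1 - r E) + r E)^(n+j) g = g], all of whose terms are nonnegative.  The
    induction follows Pascal's rule and applies the hypotheses to [(1 - r E) g]
    and [E g]; hence [g] is generalized.  The factor [rising n j] makes this a
    decay estimate as [n] grows, at the price of shifting the argument by [j]. *)
Lemma cm_binomial_bound (r : R) (j n : nat) (g : R -> R) (z : R) :
  (0 <= r <= 1)%R -> completely_monotone g -> (0 < z)%R ->
  (rising n j * r ^ j * rdiff r n g (z + INR j) <= INR (fact j) * g z)%R.
Proof.
  intros Hr. revert n g z. induction j; intros n g z Hg Hz.
  - simpl. rewrite Rplus_0_r, !Rmult_1_l.
    induction n; [simpl; lra|]. simpl.
    assert (H : (0 <= rdiff r n g (z + 1))%R).
    { assert (Hc : completely_monotone (rdiff r n g)).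
      { clear IHn z Hz. induction n; [exact Hg|]. exact (cm_step r _ Hr IHn). }
      apply (Hc 0%nat). lra. }
    nra.
  - revert g Hg. induction n; intros g Hg.
    + rewrite rising_0. simpl rdiff.
      assert (H : forall k y, (0 < y)%R -> (r ^ k * g (y + INR k) <= g y)%R).
      { induction k; intros y Hy.
        - simpl. rewrite Rplus_0_r; lra.
        - rewrite S_INR. simpl pow. specialize (IHk (y + 1)%R ltac:(lra)).
          replace (y + 1 + INR k)%R with (y + (INR k + 1))%R in IHk by ring.
          assert (H1 := Hg 1%nat y Hy). simpl in H1.
          assert (H2 := Hg 0%nat (y + 1)%R ltac:(lra)). simpl in H2.
          assert (r * (r ^ k * g (y + (INR k + 1))) <= r * g (y + 1))%R
            by (apply Rmult_le_compat_l; lra).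
          nra. }
      specialize (H (S j) z Hz). rewrite Rmult_assoc.
      apply Rmult_le_compat_l; [apply pos_INR | exact H].
    + assert (E : rdiff r (S n) g (z + INR (S j)) = rdiff r n (rdiff r 1 g) (z + INR (S j))).
      { now rewrite rdiff_step. }
      assert (E' : rdiff r (S n) g (z + INR (S j)) = rdiff r (S n) (fun y => g (y + 1)%R) (z + INR j)).
      { rewrite rdiff_shift, S_INR. f_equal; ring. }
      rewrite rising_pascal, !Rmult_plus_distr_r. rewrite E at 1. rewrite E'.
      assert (H1 := IHn (rdiff r 1 g) (cm_step r g Hr Hg)).
      assert (H2 := IHj (S n) (fun y => g (y + 1)%R) z (cm_shift g Hg) Hz).
      change (rdiff r 1 g z) with (g z - r * g (z + 1))%R in H1. rewrite fact_simpl, mult_INR in H1 |- *.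
      set (u := rdiff r (S n) (fun y => g (y + 1)%R) (z + INR j)) in *.
      assert (H3 := pos_INR (S j)).
      simpl pow in H1 |- *.
      assert (H4 : (INR (S j) * r * (rising (S n) j * r ^ j * u) <= INR (S j) * r * (INR (fact j) * g (z + 1)))%R).
      { apply Rmult_le_compat_l; [|exact H2]. apply Rmult_le_pos; lra. }
      clear H2 E E' IHn IHj; cbv beta in *; set (v := rdiff r n (rdiff r 1 g) (z + INR (S j))) in *; clearbody u v; nra.
Qed.

(** * Domination of complex powers *)

(** Each application of [1 - E] trades, by the mean value inequality on
    [[z, z + 1]], one derivative for one difference. *)
Lemma dominates_of_derivatives (F : nat -> R -> C) (G : nat -> R -> R) :
  (forall j z, (0 < z)%R -> derivC (F j) z (- F (S j) z)) ->
  (forall j z, (0 < z)%R -> is_derive (G j) z (- G (S j) z)%R) ->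
  (forall j z, (0 < z)%R -> (Cmod (F j z) <= G j z)%R) ->
  dominates (G 0%nat) (F 0%nat).
Proof.
  intros HF HG Hle.
  enough (H : forall i j z, (0 < z)%R -> (Cmod (fdiff 1 i (F j) z) <= rdiff 1 i (G j) z)%R).
  { intros i z Hz. now apply H. }
  induction i; intros j z Hz; [now apply Hle|].
  simpl. rewrite Cmult_1_l, Rmult_1_l.
  apply (mean_value_dominated _ (fun y => - fdiff 1 i (F (S j)) y) _ (fun y => rdiff 1 i (G (S j)) y)).
  - lra.
  - intros t Ht. replace (- fdiff 1 i (F (S j)) t) with (fdiff 1 i (fun y => - (1) * F (S j) y) t)
      by (rewrite fdiff_scal; ring).
    apply derivC_fdiff; [lra|]. intros y Hy.
    replace (- (1) * F (S j) y) with (- F (S j) y) by ring. now apply HF.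
  - intros t Ht. replace (- rdiff 1 i (G (S j)) t)%R with (rdiff 1 i (fun y => -1 * G (S j) y)%R t)
      by (rewrite rdiff_scal; ring).
    apply is_derive_rdiff; [lra|]. intros y Hy.
    replace (-1 * G (S j) y)%R with (- G (S j) y)%R by ring. now apply HG.
  - intros t Ht. rewrite Cmod_opp. apply IHi. lra.
Qed.

(** The Pochhammer symbol [p (p + 1) ... (p + n - 1)]. *)
Fixpoint poch (p : C) (n : nat) : C :=
  match n with O => 1 | S n => poch p n * (p + RtoC (INR n)) end.

Fixpoint rpoch (q : R) (n : nat) : R :=
  match n with O => 1 | S n => (rpoch q n * (q + INR n))%R end.

Lemma rpoch_pos (q : R) (n : nat) : (0 < q)%R -> (0 < rpoch q n)%R.
Proof.
  intro Hq. induction n; simpl; [lra|].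
  apply Rmult_lt_0_compat; [exact IHn|]. assert (H := pos_INR n). lra.
Qed.

(** With [q = Re p] and [t = Im p], the ratio of the two symbols is a product of
    factors [|p + j| / (q + j) <= 1 + t^2 / (2 (q + j)^2)], and this product
    converges.  The bound in the induction telescopes
    [c / (q + j) - c / (q + j + 1)], where [c] is chosen so that this difference
    is at least [t^2 / (2 (q + j)^2)]. *)
Lemma poch_le (p : C) :
  (0 < Re p)%R -> exists K, (0 <= K)%R /\
    forall n, (Cmod (poch p n) <= K * rpoch (Re p) n)%R.
Proof.
  intro Hp. set (q := Re p) in *. set (t := Im p).
  (* [(q + 1) / q] is the largest value of [(q + j + 1) / (q + j)] *)
  set (c := (t ^ 2 * (q + 1) / (2 * q))%R).
  assert (Hc : (0 <= c)%R).
  { unfold c. apply Rmult_le_pos; [nra|]. apply Rlt_le, Rinv_0_lt_compat; lra. }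
  assert (H : forall n, (Cmod (poch p n) <= exp (c / q - c / (q + INR n)) * rpoch q n)%R).
  { induction n.
    - simpl. rewrite Cmod_1. replace (c / q - c / (q + 0))%R with 0%R by (field; lra).
      rewrite exp_0; lra.
    - change (poch p (S n)) with (poch p n * (p + RtoC (INR n))).
      change (rpoch q (S n)) with (rpoch q n * (q + INR n))%R.
      rewrite Cmod_mult, S_INR. assert (Hn := pos_INR n). set (m := INR n) in *.
      set (d := (c / ((q + m) * (q + m + 1)))%R).
      assert (Hd : (0 <= d)%R).
      { unfold d. apply Rmult_le_pos; [exact Hc|]. apply Rlt_le, Rinv_0_lt_compat.
        apply Rmult_lt_0_compat; lra. }
      assert (Hmod : (Cmod (p + RtoC m) <= (q + m) * (1 + d))%R).
      { assert (Hq2 : (t ^ 2 <= 2 * d * (q + m) ^ 2)%R).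
        { unfold d, c.
          replace (2 * (t ^ 2 * (q + 1) / (2 * q) / ((q + m) * (q + m + 1))) * (q + m) ^ 2)%R
            with (t ^ 2 * (((q + 1) * (q + m)) / (q * (q + m + 1))))%R by (field; lra).
          rewrite <- (Rmult_1_r (t ^ 2)) at 1. apply Rmult_le_compat_l; [nra|].
          apply Rmult_le_reg_r with (q * (q + m + 1))%R; [apply Rmult_lt_0_compat; lra|].
          unfold Rdiv. rewrite Rmult_assoc, Rinv_l; [nra|].
          apply Rgt_not_eq. apply Rmult_lt_0_compat; lra. }
        assert (E : (Cmod (p + RtoC m) ^ 2 = (q + m) ^ 2 + t ^ 2)%R).
        { rewrite Cmod2_alt. unfold q, t, Re, Im; simpl. ring. }
        apply Rsqr_incr_0_var; [|nra]. unfold Rsqr. nra. }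
      replace (c / q - c / (q + (m + 1)))%R with ((c / q - c / (q + m)) + d)%R
        by (unfold d; field; lra).
      rewrite exp_plus.
      assert (Hexp := exp_ineq1_le d).
      assert (P1 := exp_pos (c / q - c / (q + m))). assert (P2 := rpoch_pos q n Hp).
      assert (P3 := Cmod_ge_0 (poch p n)).
      apply Rle_trans with ((exp (c / q - c / (q + m)) * rpoch q n) * ((q + m) * (1 + d)))%R.
      + apply Rmult_le_compat; auto. apply Cmod_ge_0.
      + replace (exp (c / q - c / (q + m)) * exp d * (rpoch q n * (q + m)))%R
          with ((exp (c / q - c / (q + m)) * rpoch q n) * ((q + m) * exp d))%R by ring.
        apply Rmult_le_compat_l; [nra|]. apply Rmult_le_compat_l; lra. }
  exists (exp (c / q)). split; [apply Rlt_le, exp_pos|].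
  intro n. eapply Rle_trans; [apply H|].
  apply Rmult_le_compat_r; [apply Rlt_le, rpoch_pos, Hp|].
  assert (Hn := pos_INR n).
  assert (0 <= c / (q + INR n))%R.
  { apply Rmult_le_pos; [exact Hc|]. apply Rlt_le, Rinv_0_lt_compat. lra. }
  destruct (Req_dec (c / (q + INR n)) 0) as [e|e].
  - rewrite e, Rminus_0_r. lra.
  - apply Rlt_le, exp_increasing. lra.
Qed.

Lemma powneg_dominated (p : C) :
  (0 < Re p)%R -> exists K, (0 <= K)%R /\
    dominates (fun z => K * rpowneg (Re p) z)%R (powneg p).
Proof.
  intro Hp. destruct (poch_le p Hp) as [K [HK0 HK]]. exists K; split; [exact HK0|].
  assert (H := dominates_of_derivatives (fun j z => poch p j * powneg (p + RtoC (INR j)) z)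
    (fun j z => K * rpoch (Re p) j * rpowneg (Re p + INR j) z)%R).
  assert (D : dominates (fun z => K * rpoch (Re p) 0 * rpowneg (Re p + INR 0) z)%R
                (fun z => poch p 0 * powneg (p + RtoC (INR 0)) z)).
  { apply H.
    - intros j z Hz. rewrite S_INR, RtoC_plus.
      replace (- (poch p (S j) * powneg (p + (RtoC (INR j) + 1)) z))
        with (poch p j * (- (p + RtoC (INR j)) * powneg (p + RtoC (INR j) + 1) z)).
      2:{ rewrite Cplus_assoc. simpl poch. ring. }
      apply derivC_scal. now apply derivC_powneg.
    - intros j z Hz. rewrite S_INR.
      replace (- (K * rpoch (Re p) (S j) * rpowneg (Re p + (INR j + 1)) z))%R
        with (K * rpoch (Re p) j * - ((Re p + INR j) * rpowneg (Re p + INR j + 1) z))%R.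
      2:{ rewrite Rplus_assoc. simpl rpoch. ring. }
      apply (is_derive_scal (rpowneg (Re p + INR j))). now apply is_derive_rpowneg.
    - intros j z Hz. rewrite Cmod_mult, Cmod_powneg. simpl Re.
      replace (Re p + INR j)%R with (fst p + INR j)%R by reflexivity.
      apply Rmult_le_compat_r; [apply Rlt_le, rpowneg_pos | apply HK]. }
  intros i z Hz. specialize (D i z Hz).
  rewrite fdiff_scal, rdiff_scal in D. simpl poch in D. simpl rpoch in D.
  rewrite Cmult_1_l, Rmult_1_r in D. rewrite rdiff_scal.
  rewrite Rplus_0_r in D. simpl INR in D.
  replace (p + RtoC 0) with p in D by ring. exact D.
Qed.

(** The constant depends neither on [x] nor on [n], which the passage to the
    boundary of the domain of [x] requires. *)
Lemma fdiff_powneg_dominated (p : C) :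
  (0 < Re p)%R -> exists K, (0 <= K)%R /\
    forall x n j z, (Cmod (1 - x) <= 1)%R -> (0 < z)%R ->
    (rising n j * (1 - Cmod (1 - x)) ^ j * Cmod (fdiff x n (powneg p) (z + INR j))
      <= INR (fact j) * (K * rpowneg (Re p) z))%R.
Proof.
  intro Hp. destruct (powneg_dominated p Hp) as [K [HK0 HK]]. exists K; split; [exact HK0|].
  intros x n j z Hx Hz.
  assert (Hr : (0 <= 1 - Cmod (1 - x) <= 1)%R) by (assert (H := Cmod_ge_0 (1 - x)); lra).
  assert (H := dominates_fdiff x n _ _ HK 0%nat (z + INR j)%R ltac:(assert (H := pos_INR j); lra)).
  eapply Rle_trans; [|apply (cm_binomial_bound _ j n _ z Hr (dominates_cm _ _ HK) Hz)].
  apply Rmult_le_compat_l; [|exact H].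
  apply Rmult_le_pos; [apply Rlt_le, rising_pos | apply pow_le; lra].
Qed.

(** * Bounds and decay of the weighted differences of powers *)

(** Domination is available in the half plane [Re p > 0] only; statements are
    carried to all exponents by steps of [-1]. *)
Lemma exponent_ind (P : C -> Prop) :
  (forall p, (0 < Re p)%R -> P p) -> (forall p, P (p + 1) -> P p) -> forall p, P p.
Proof.
  intros H0 H1 p.
  destruct (INR_unbounded (- Re p)) as [n Hn].
  assert (H : forall k q, (0 < Re q + INR k)%R -> P q).
  { induction k; intros q Hq.
    - apply H0. simpl in Hq. lra.
    - apply H1, IHk. rewrite S_INR in Hq. unfold Re in *; simpl in *. lra. }
  apply (H n). lra.
Qed.

Lemma fdiff_powneg_succ (x p : C) (n : nat) (z : R) :
  (0 < z)%R ->
  fdiff x (S n) (powneg p) z = z * fdiff x (S n) (powneg (p + 1)) z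
     - RtoC (INR (S n)) * x * fdiff x n (powneg (p + 1)) (z + 1)%R.
Proof.
  intro Hz. rewrite <- fdiff_mul_id. apply fdiff_ext_pos; [exact Hz|].
  intros y Hy. now apply powneg_succ.
Qed.

Lemma rho_pos (x : C) : (Cmod (1 - x) < 1)%R -> (0 < 1 - Cmod (1 - x) <= 1)%R.
Proof. assert (H := Cmod_ge_0 (1 - x)). lra. Qed.

Lemma Cmod_le_2 (x : C) : (Cmod (1 - x) <= 1)%R -> (Cmod x <= 2)%R.
Proof.
  intro H. assert (T := Cmod_triangle 1 (- (1 - x))). rewrite Cmod_opp, Cmod_1 in T.
  replace (1 + - (1 - x)) with x in T by ring. lra.
Qed.

(** Lowering the exponent costs a factor [n] and a shift of the argument, by
    [fdiff_powneg_succ]; the case [j + 1] for the higher exponent pays for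
    both, so the induction needs all [j] at once. *)
Lemma fdiff_powneg_bound (x : C) (Hx : (Cmod (1 - x) < 1)%R) (p : C) :
  exists q A, forall j, exists K, forall n z, (0 < z)%R ->
    (rising n j * Cmod (fdiff x n (powneg p) (z + INR j)) <= K * ((1 + z) ^ A * rpowneg q z))%R.
Proof.
  revert p. apply exponent_ind.
  - intros p Hp. exists (Re p), 0%nat. intro j.
    destruct (fdiff_powneg_dominated p Hp) as [K [HK0 HK]].
    assert (Hr := pow_lt _ j (proj1 (rho_pos x Hx))). set (r := ((1 - Cmod (1 - x)) ^ j)%R) in *.
    exists (INR (fact j) * K / r)%R. intros n z Hz.
    specialize (HK x n j z ltac:(lra) Hz). fold r in HK.
    apply Rmult_le_reg_l with r; [exact Hr|]. simpl pow.
    replace (r * (INR (fact j) * K / r * (1 * rpowneg (Re p) z)))%R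
      with (INR (fact j) * (K * rpowneg (Re p) z))%R by (field; lra).
    lra.
  - intros p (q & A & H). exists q, (S A). intro j.
    destruct (H j) as [K1 H1]. destruct (H (S j)) as [K2 H2].
    exists ((1 + INR j) * K1 + 2 * K2)%R. intros n z Hz.
    assert (Hj := pos_INR j). assert (Hzj : (0 < z + INR j)%R) by lra.
    specialize (H1 n z Hz). set (B := ((1 + z) ^ A * rpowneg q z)%R) in *.
    assert (HB : (0 < B)%R) by (apply Rmult_lt_0_compat; [apply pow_lt; lra | apply rpowneg_pos]).
    assert (HV := rising_pos n j).
    assert (HK1 : (0 <= K1)%R).
    { assert (T := Cmod_ge_0 (fdiff x n (powneg (p + 1)) (z + INR j))). nra. }
    assert (HK2 : (0 <= K2)%R).
    { assert (T := Cmod_ge_0 (fdiff x n (powneg (p + 1)) (z + INR (S j)))).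
      assert (T2 := rising_pos n (S j)). specialize (H2 n z Hz). fold B in H2. nra. }
    replace (((1 + INR j) * K1 + 2 * K2) * ((1 + z) ^ S A * rpowneg q z))%R
      with (((1 + INR j) * (1 + z)) * (K1 * B) + (1 + z) * (2 * (K2 * B)))%R
      by (unfold B; simpl; ring).
    assert (G1 : (rising n j * ((z + INR j) * Cmod (fdiff x n (powneg (p + 1)) (z + INR j))) <=
       ((1 + INR j) * (1 + z)) * (K1 * B))%R).
    { replace (rising n j * ((z + INR j) * Cmod (fdiff x n (powneg (p + 1)) (z + INR j))))%R
        with ((z + INR j) * (rising n j * Cmod (fdiff x n (powneg (p + 1)) (z + INR j))))%R by ring.
      assert (T := Cmod_ge_0 (fdiff x n (powneg (p + 1)) (z + INR j))).
      apply Rmult_le_compat; [lra | nra | nra | exact H1]. }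
    assert (HKB : (0 <= K2 * B)%R) by nra.
    destruct n as [|n].
    + simpl fdiff in *. rewrite (powneg_succ p) by exact Hzj.
      rewrite Cmod_mult, Cmod_R, Rabs_pos_eq by lra. nra.
    + rewrite fdiff_powneg_succ by exact Hzj.
      specialize (H2 n z Hz). fold B in H2.
      rewrite <- rising_shift in H2.
      rewrite (S_INR j) in H2.
      replace (z + (INR j + 1))%R with (z + INR j + 1)%R in H2 by ring.
      assert (T := Cmod_triangle (RtoC (z + INR j) * fdiff x (S n) (powneg (p + 1)) (z + INR j))
        (- (RtoC (INR (S n)) * x * fdiff x n (powneg (p + 1)) (z + INR j + 1)%R))).
      rewrite Cmod_opp, !Cmod_mult, !Cmod_R in T.
      rewrite (Rabs_pos_eq (z + INR j)), (Rabs_pos_eq (INR (S n))) in T by (try apply pos_INR; lra).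
      eapply Rle_trans; [apply Rmult_le_compat_l; [lra | exact T]|].
      rewrite Rmult_plus_distr_l. apply Rplus_le_compat; [exact G1|].
      assert (Hx2 := Cmod_le_2 x ltac:(lra)). assert (Hx0 := Cmod_ge_0 x).
      set (w := Cmod (fdiff x n (powneg (p + 1)) (z + INR j + 1)%R)) in *.
      replace (rising (S n) j * (INR (S n) * Cmod x * w))%R
        with (Cmod x * (INR (S n) * rising (S n) j * w))%R by ring.
      assert (0 <= INR (S n) * rising (S n) j * w)%R.
      { apply Rmult_le_pos; [|apply Cmod_ge_0]. apply Rmult_le_pos; [apply pos_INR | lra]. }
      nra.
Qed.

Lemma derivC_fdiff_powneg (x p : C) (n : nat) (z : R) :
  (0 < z)%R -> derivC (fdiff x n (powneg p)) z (- p * fdiff x n (powneg (p + 1)) z).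
Proof.
  intro Hz. rewrite <- fdiff_scal. apply derivC_fdiff; [exact Hz|].
  intros y Hy. now apply derivC_powneg.
Qed.

Lemma rpowneg_bound (q a u b : R) :
  (0 < a)%R -> (a <= u <= b)%R -> (rpowneg q u <= exp (Rabs q * (Rabs (ln a) + Rabs (ln b))))%R.
Proof.
  intros Ha [Hu1 Hu2]. unfold rpowneg. apply exp_mono.
  assert (H1 := ln_le a u Ha Hu1). assert (H2 := ln_le u b ltac:(lra) Hu2).
  assert (H : (Rabs (ln u) <= Rabs (ln a) + Rabs (ln b))%R).
  { unfold Rabs; repeat destruct Rcase_abs; lra. }
  eapply Rle_trans; [apply Rle_abs|]. rewrite Rabs_mult, Rabs_Ropp.
  apply Rmult_le_compat_l; [apply Rabs_pos | exact H].
Qed.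

(** At [z + d] with [d > 0] the bound with [j = 1] gives decay like [1 / n]. At
    [z = 1] itself that bound would refer to the point [0]; instead [z] is
    compared with [z + d], the derivative being bounded uniformly in [n]. *)
Lemma fdiff_powneg_vanish_unif (x : C) (Hx : (Cmod (1 - x) < 1)%R) (p : C) (Y eps : R) :
  (0 < eps)%R -> exists N, forall n z, (N <= n)%nat -> (1 <= z <= Y)%R ->
    (Cmod (fdiff x n (powneg p) z) <= eps)%R.
Proof.
  intro Heps.
  destruct (Rlt_le_dec Y 1) as [HY|HY].
  { exists 0%nat. intros; lra. }
  destruct (fdiff_powneg_bound x Hx p) as (q & A & H1).
  destruct (fdiff_powneg_bound x Hx (p + 1)) as (q' & A' & H0).
  destruct (H1 1%nat) as [K1 HK1]. destruct (H0 0%nat) as [K0 HK0]. clear H0 H1.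
  (* bounds the derivative on [1, Y + 1], so that a shift by [d <= 1] is covered *)
  set (M := (Rabs K0 * ((2 + Y) ^ A' * exp (Rabs q' * (Rabs (ln 1) + Rabs (ln (Y + 1))))))%R).
  assert (HM : forall n y, (1 <= y <= Y + 1)%R -> (Cmod (fdiff x n (powneg (p + 1)) y) <= M)%R).
  { intros n y Hy. specialize (HK0 n y ltac:(lra)). simpl in HK0.
    rewrite Rplus_0_r, Rmult_1_l in HK0.
    eapply Rle_trans; [exact HK0|].
    assert (B : (0 <= (1 + y) ^ A' * rpowneg q' y)%R).
    { apply Rmult_le_pos; [apply pow_le; lra | apply Rlt_le, rpowneg_pos]. }
    apply Rle_trans with (Rabs K0 * ((1 + y) ^ A' * rpowneg q' y))%R.
    { apply Rmult_le_compat_r; [exact B | apply Rle_abs]. }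
    apply Rmult_le_compat_l; [apply Rabs_pos|].
    apply Rmult_le_compat; [apply pow_le; lra | apply Rlt_le, rpowneg_pos | apply pow_incr; lra |].
    apply rpowneg_bound; lra. }
  assert (HM0 : (0 <= M)%R).
  { eapply Rle_trans; [apply Cmod_ge_0 | apply (HM 0%nat 1%R); lra]. }
  (* the summand 1 keeps the divisor in [d] positive *)
  set (L := (Cmod p * M + 1)%R).
  assert (HL : (0 < L)%R) by (assert (T := Cmod_ge_0 p); unfold L; nra).
  set (d := Rmin 1 (eps / (2 * L))).
  assert (Hd : (0 < d)%R).
  { unfold d. apply Rmin_glb_lt; [lra|]. apply Rdiv_lt_0_compat; lra. }
  assert (Hd1 : (d <= 1)%R) by apply Rmin_l.
  assert (HdL : (d * L <= eps / 2)%R).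
  { apply Rle_trans with (eps / (2 * L) * L)%R.
    - apply Rmult_le_compat_r; [lra | apply Rmin_r].
    - right; field; lra. }
  set (B := (Rabs K1 * ((1 + Y) ^ A * exp (Rabs q * (Rabs (ln d) + Rabs (ln Y)))))%R).
  assert (HB : forall n z, (1 <= z <= Y)%R ->
     (INR (S n) * Cmod (fdiff x n (powneg p) (z + d)%R) <= B)%R).
  { intros n z Hz. specialize (HK1 n (z - 1 + d)%R ltac:(lra)).
    replace (rising n 1) with (INR (S n)) in HK1
      by (simpl rising; replace (n + 1)%nat with (S n) by lia; ring).
    replace (z - 1 + d + INR 1)%R with (z + d)%R in HK1 by (simpl; ring).
    eapply Rle_trans; [exact HK1|].
    set (u := (z - 1 + d)%R) in *.
    assert (Hu : (d <= u <= Y)%R) by (unfold u; lra).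
    apply Rle_trans with (Rabs K1 * ((1 + u) ^ A * rpowneg q u))%R.
    { apply Rmult_le_compat_r; [|apply Rle_abs].
      apply Rmult_le_pos; [apply pow_le; lra | apply Rlt_le, rpowneg_pos]. }
    apply Rmult_le_compat_l; [apply Rabs_pos|].
    apply Rmult_le_compat; [apply pow_le; lra | apply Rlt_le, rpowneg_pos | apply pow_incr; lra |].
    apply rpowneg_bound; lra. }
  destruct (INR_unbounded (2 * B / eps)) as [N HN].
  exists N. intros n z Hn Hz.
  assert (HnN : (INR N <= INR n)%R) by (now apply le_INR).
  assert (D : (Cmod (fdiff x n (powneg p) z - fdiff x n (powneg p) (z + d)%R) <= (Cmod p * M) * (z + d - z))%R).
  { apply (mean_value_bound _ (fun y => - p * fdiff x n (powneg (p + 1)) y)); [lra| |].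
    - intros t Ht. apply derivC_fdiff_powneg. lra.
    - intros t Ht. rewrite Cmod_mult, Cmod_opp.
      apply Rmult_le_compat_l; [apply Cmod_ge_0 | apply HM; lra]. }
  specialize (HB n z Hz). rewrite S_INR in HB.
  assert (G : (Cmod (fdiff x n (powneg p) (z + d)%R) <= eps / 2)%R).
  { apply Rmult_le_reg_l with (INR n + 1)%R; [assert (T := pos_INR n); lra|].
    eapply Rle_trans; [exact HB|].
    assert (HN' : (2 * B / eps * eps < (INR n + 1) * eps)%R) by (apply Rmult_lt_compat_r; lra).
    replace (2 * B / eps * eps)%R with (2 * B)%R in HN' by (field; lra). lra. }
  replace (fdiff x n (powneg p) z) with
    ((fdiff x n (powneg p) z - fdiff x n (powneg p) (z + d)%R) + fdiff x n (powneg p) (z + d)%R) by ring.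
  eapply Rle_trans; [apply Cmod_triangle|]. unfold L in HdL. nra.
Qed.

Lemma fdiff_powneg_vanish (x : C) (Hx : (Cmod (1 - x) < 1)%R) (p : C) (z : R) :
  (1 <= z)%R -> Clim (fun n => fdiff x n (powneg p) z) 0.
Proof.
  intro Hz. apply Clim_eps. intro eps.
  assert (He : (0 < eps / 2)%R) by (destruct eps; simpl; lra).
  destruct (fdiff_powneg_vanish_unif x Hx p z _ He) as [N HN].
  exists N. intros n Hn. specialize (HN n z Hn ltac:(lra)).
  replace (fdiff x n (powneg p) z - 0) with (fdiff x n (powneg p) z) by ring. lra.
Qed.

(** * The logarithmic series *)

(** Unlike the defining arccosine, the arctangent is differentiable across the
    real axis. *)
Lemma Carg_atan (z : C) : (0 < Re z)%R -> Carg z = atan (Im z / Re z).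
Proof.
  intro Hz. set (a := Re z) in *. set (b := Im z).
  assert (Hm2 : (Cmod z ^ 2 = a ^ 2 + b ^ 2)%R) by apply Cmod2_alt.
  assert (Hm : (0 < Cmod z)%R).
  { assert (T := Cmod_ge_0 z). destruct (Req_dec (Cmod z) 0) as [e|e]; [|lra].
    rewrite e in Hm2. nra. }
  assert (E : (acos (a / Cmod z) = atan (Rabs b / a))%R).
  { rewrite acos_atan by (apply Rdiv_lt_0_compat; assumption). f_equal.
    replace (1 - (a / Cmod z)²)%R with (Rsqr (Rabs b / Cmod z))%R.
    - rewrite sqrt_Rsqr.
      + field. split; lra.
      + apply Rmult_le_pos; [apply Rabs_pos | apply Rlt_le, Rinv_0_lt_compat, Hm].
    - unfold Rdiv. rewrite !Rsqr_mult, <- Rsqr_abs.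
      assert (H1 : (Rsqr (/ Cmod z) * (Cmod z ^ 2) = 1)%R) by (unfold Rsqr; field; lra).
      rewrite Hm2 in H1. unfold Rsqr in *. nra. }
  unfold Carg. fold a b. rewrite E.
  destruct (Rle_dec 0 b) as [Hb|Hb].
  - now rewrite Rabs_pos_eq.
  - rewrite Rabs_left by lra. rewrite <- atan_opp. f_equal. field. lra.
Qed.

Lemma derivC_log_path (y : C) (r : R) :
  (0 < 1 - r * Re y)%R ->
  derivC (fun t => Clog (1 - RtoC t * y)) r (- y / (1 - RtoC r * y)).
Proof.
  destruct y as [u v]. simpl Re. intro Hpos.
  assert (Hsq : (0 < (1 - r * u) ^ 2 + (r * v) ^ 2)%R) by nra.
  assert (Hne : (1 - RtoC r * ((u, v) : C)) <> 0).
  { intro H. apply (f_equal Re) in H. unfold Re, RtoC, Cminus, Cplus, Copp, Cmult in H; simpl in H. lra. }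
  assert (E : - (u, v) / (1 - RtoC r * ((u, v) : C)) =
    ((- u + r * (u ^ 2 + v ^ 2)) / ((1 - r * u) ^ 2 + (r * v) ^ 2),
     - v / ((1 - r * u) ^ 2 + (r * v) ^ 2))%R).
  { unfold RtoC, Cdiv, Cinv, Cminus, Cplus, Copp, Cmult; simpl. f_equal; field; nra. }
  rewrite E. split; simpl Re; simpl Im.
  - apply is_derive_ext with (fun t => ln (sqrt ((1 - t * u) ^ 2 + (t * v) ^ 2))).
    { intro t. change (AbsRing.sort R_AbsRing) with R in t. unfold Clog, Cmod, RtoC, Cminus, Cplus, Copp, Cmult; simpl. apply (f_equal (fun w : R => ln (sqrt w))). ring. }
    auto_derive.
    + split; [nra|]. split; [|trivial]. apply sqrt_lt_R0. nra.
    + assert (Hs := sqrt_sqrt _ (Rlt_le _ _ Hsq)). assert (Hs0 := sqrt_lt_R0 _ Hsq).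
      simpl in Hs, Hs0 |- *. set (w := sqrt _) in *.
      replace ((1 - r * u) * ((1 - r * u) * 1) + r * v * (r * v * 1))%R with (w * w)%R by lra.
      field. lra.
  - apply is_derive_ext_loc with (fun t => atan (- (t * v) / (1 - t * u))).
    { assert (Hd : (0 < (1 - r * u) / (1 + Rabs u))%R).
      { apply Rdiv_lt_0_compat; [lra|]. assert (T := Rabs_pos u). lra. }
      exists (mkposreal _ Hd). intros t Ht.
      assert (Ht' : (Rabs (t - r) < (1 - r * u) / (1 + Rabs u))%R) by exact Ht.
      assert (Hu := Rabs_pos u).
      assert (Hq : (Rabs (t - r) * (1 + Rabs u) < 1 - r * u)%R).
      { apply Rmult_lt_compat_r with (r := (1 + Rabs u)%R) in Ht'; [|lra].
        unfold Rdiv in Ht'. rewrite Rmult_assoc, Rinv_l in Ht' by lra. lra. }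
      assert (Hz : (0 < 1 - t * u)%R).
      { assert (T := Rle_abs ((t - r) * u)). rewrite Rabs_mult in T.
        assert (T2 := Rabs_pos (t - r)). nra. }
      unfold Clog. simpl. rewrite Carg_atan.
      - f_equal. unfold Re, Im, RtoC, Cminus, Cplus, Copp, Cmult; simpl. unfold Rdiv. apply f_equal2; [|apply f_equal]; ring.
      - unfold Re, RtoC, Cminus, Cplus, Copp, Cmult; simpl. lra. }
    auto_derive; [lra|]. field. split; [|lra]. nra.
Qed.

Lemma Clog_1 : Clog 1 = 0.
Proof.
  unfold Clog. rewrite Cmod_1, ln_1, Carg_atan by (simpl; lra).
  simpl. replace (0 / 1)%R with 0%R by field. now rewrite atan_0.
Qed.

Lemma derivC_pow (y : C) (n : nat) (r : R) :
  derivC (fun t => RtoC (t ^ S n) * (y ^ S n / RtoC (INR (S n)))) r (y * (RtoC r * y) ^ n).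
Proof.
  assert (Hn : RtoC (INR (S n)) <> 0).
  { intro H. apply RtoC_inj in H. now apply (not_0_INR (S n)). }
  replace (y * (RtoC r * y) ^ n) with
    (RtoC (INR (S n) * r ^ n) * (y ^ S n / RtoC (INR (S n))) + RtoC (r ^ S n) * 0).
  2:{ rewrite RtoC_mult, RtoC_pow, Cpow_mult_l, Cpow_S. field. exact Hn. }
  apply (derivC_mult (fun t => RtoC (t ^ S n)) (fun _ => _)); [|apply derivC_const].
  split; unfold RtoC, Re, Im; cbn [fst snd].
  - auto_derive; [trivial|]. change (match n with O => 1 | S _ => INR n + 1 end)%R with (INR (S n)). ring.
  - apply (is_derive_const (K := R_AbsRing) (V := R_NormedModule)).
Qed.

(** Along the segment from [1] to [1 - y] the derivative of the remainder is
    the tail of a geometric series, hence uniformly small. *)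
Lemma Clog_series (y : C) :
  (Cmod y < 1)%R ->
  Cseries (fun n => y ^ S n / RtoC (INR (S n))) (- Clog (1 - y)).
Proof.
  intro Hy. assert (Hy0 := Cmod_ge_0 y).
  assert (Hre : forall r, (0 <= r <= 1)%R -> (1 - Cmod y <= 1 - r * Re y)%R).
  { intros r Hr. assert (H1 := re_le_Cmod y). assert (H2 := Rle_abs (Re y)).
    assert (H3 := Rabs_pos (Re y)). nra. }
  set (F := fun N r => sum_n (fun n => RtoC (r ^ S n) * (y ^ S n / RtoC (INR (S n)))) N
                  + Clog (1 - RtoC r * y)).
  set (F' := fun N (r : R) => - y * (RtoC r * y) ^ (S N) / (1 - RtoC r * y)).
  assert (Hne : forall r, (0 <= r <= 1)%R -> (1 - RtoC r * y) <> 0).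
  { intros r Hr H. specialize (Hre r Hr).
    apply (f_equal Re) in H. unfold Re, RtoC, Cminus, Cplus, Copp, Cmult in H, Hre; simpl in H, Hre. lra. }
  assert (HF : forall N r, (0 <= r <= 1)%R -> derivC (F N) r (F' N r)).
  { intros N r Hr. specialize (Hre r Hr).
    assert (HS : derivC (fun t => sum_n (fun n => RtoC (t ^ S n) * (y ^ S n / RtoC (INR (S n)))) N) r
       (sum_n (fun n => y * (RtoC r * y) ^ n) N)).
    { apply derivC_sum_n. intro n. apply derivC_pow. }
    assert (E : F' N r = sum_n (fun n => y * (RtoC r * y) ^ n) N + - y / (1 - RtoC r * y)).
    { unfold F'. clear HS. induction N.
      - rewrite sum_O. simpl. field. now apply Hne.
      - rewrite sum_n_C_S.
        replace (sum_n (fun n => y * (RtoC r * y) ^ n) N) with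
          (- y * (RtoC r * y) ^ S N / (1 - RtoC r * y) - - y / (1 - RtoC r * y)).
        + rewrite !Cpow_S. field. now apply Hne.
        + rewrite IHN. ring. }
    rewrite E. apply derivC_plus; [exact HS|]. apply derivC_log_path. lra. }
  apply Cseries_Clim.
  apply Clim_squeeze with (fun N => / (1 - Cmod y) * Cmod y ^ S N)%R.
  - intro N.
    assert (E0 : F N 0%R = 0).
    { unfold F. replace (1 - 0%R * y) with (RtoC 1) by ring. rewrite Clog_1, Cplus_0_r.
      induction N; [rewrite sum_O|rewrite sum_n_C_S, IHN]; rewrite pow_i by lia; ring. }
    assert (E1 : F N 1%R = sum_n (fun n => y ^ S n / RtoC (INR (S n))) N + Clog (1 - y)).
    { unfold F. replace (1 - 1%R * y) with (1 - y) by ring. f_equal.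
      apply sum_n_ext. intro n. rewrite pow1. apply Cmult_1_l. }
    replace (sum_n (fun n => y ^ S n / RtoC (INR (S n))) N - - Clog (1 - y))
      with (- (F N 0%R - F N 1%R)) by (rewrite E0, E1; ring).
    rewrite Cmod_opp.
    replace (/ (1 - Cmod y) * Cmod y ^ S N)%R with (/ (1 - Cmod y) * Cmod y ^ S N * (1 - 0))%R by ring.
    apply (mean_value_bound _ (F' N)); [lra | intros; now apply HF|].
    intros t Ht. unfold F'. specialize (Hne t Ht). specialize (Hre t Ht).
    unfold Cdiv. rewrite !Cmod_mult, Cmod_inv, Cmod_opp, Cmod_pow, Cmod_mult, Cmod_R by exact Hne.
    rewrite Rmult_comm. apply Rmult_le_compat.
    + apply Rlt_le, Rinv_0_lt_compat. now apply Cmod_gt_0.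
    + apply Rmult_le_pos; [lra|]. apply pow_le. apply Rmult_le_pos; [apply Rabs_pos | lra].
    + apply Rinv_le_contravar; [lra|].
      assert (T := re_le_Cmod (1 - RtoC t * y)).
      replace (Re (1 - RtoC t * y)) with (1 - t * Re y)%R in T
        by (unfold Re, RtoC, Cminus, Cplus, Copp, Cmult; simpl; ring).
      rewrite Rabs_pos_eq in T by lra. lra.
    + rewrite Rabs_pos_eq by lra.
      apply Rle_trans with (1 * Cmod y ^ S N)%R; [|lra].
      apply Rmult_le_compat; [lra | apply pow_le; nra | lra | apply pow_incr; nra ].
  - replace 0%R with (/ (1 - Cmod y) * 0)%R by ring.
    apply is_lim_seq_mult'; [apply is_lim_seq_const|].
    apply (is_lim_seq_incr_1 (fun n => Cmod y ^ n)%R).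
    apply is_lim_seq_geom. now rewrite Rabs_pos_eq.
Qed.

(** * The remainder of the Newton series of a derivative *)

(** This is [W_N f = (log x) f + f' + sum_(1 <= n <= N) (1 - x E)^n f / n] for
    the function [f z = z^-p]. *)
Fixpoint newton_rem (x p : C) (N : nat) (z : R) : C :=
  match N with
  | O => Clog x * powneg p z - p * powneg (p + 1) z
  | S n => newton_rem x p n z + fdiff x (S n) (powneg p) z / RtoC (INR (S n))
  end.

Lemma newton_rem_0 (x p : C) (z : R) :
  newton_rem x p 0 z = Clog x * powneg p z - p * powneg (p + 1) z.
Proof. reflexivity. Qed.

Lemma newton_rem_S (x p : C) (N : nat) (z : R) :
  newton_rem x p (S N) z = newton_rem x p N z + fdiff x (S N) (powneg p) z / RtoC (INR (S N)).
Proof. reflexivity. Qed.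

Lemma INR_S_neq_0 (n : nat) : RtoC (INR (S n)) <> 0.
Proof. intro H. apply RtoC_inj in H. now apply (not_0_INR (S n)). Qed.

(** The commutators of [z] with the terms of [W_N] sum to
    [1 - x E (1 + ... + (1 - x E)^(N-1)) = (1 - x E)^N]. *)
Lemma newton_rem_succ (x p : C) (N : nat) (z : R) :
  (0 < z)%R ->
  newton_rem x p N z = z * newton_rem x (p + 1) N z + fdiff x N (powneg (p + 1)) z.
Proof.
  intro Hz. induction N.
  - simpl. rewrite (powneg_succ p z Hz), (powneg_succ (p + 1) z Hz). ring.
  - rewrite newton_rem_S.
    change (newton_rem x (p + 1) (S N) z) with
      (newton_rem x (p + 1) N z + fdiff x (S N) (powneg (p + 1)) z / RtoC (INR (S N))).
    rewrite IHN, fdiff_powneg_succ by exact Hz.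
    change (fdiff x (S N) (powneg (p + 1)) z) with
      (fdiff x N (powneg (p + 1)) z - x * fdiff x N (powneg (p + 1)) (z + 1)%R).
    field. apply INR_S_neq_0.
Qed.

Lemma derivC_newton_rem (x p : C) (N : nat) (z : R) :
  (0 < z)%R -> derivC (newton_rem x p N) z (- p * newton_rem x (p + 1) N z).
Proof.
  intro Hz. induction N.
  - simpl.
    replace (- p * (Clog x * powneg (p + 1) z - (p + 1) * powneg (p + 1 + 1) z)) with
      (Clog x * (- p * powneg (p + 1) z) + (- p) * (- (p + 1) * powneg (p + 1 + 1) z)) by ring.
    assert (T : derivC (fun u => Clog x * powneg p u + (- p) * powneg (p + 1) u) z
      (Clog x * (- p * powneg (p + 1) z) + (- p) * (- (p + 1) * powneg (p + 1 + 1) z))).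
    { apply derivC_plus; apply derivC_scal; now apply derivC_powneg. }
    refine (derivC_ext _ _ _ _ _ T). intro t. ring.
  - replace (- p * newton_rem x (p + 1) (S N) z) with
      (- p * newton_rem x (p + 1) N z
        + / RtoC (INR (S N)) * (- p * fdiff x (S N) (powneg (p + 1)) z))
      by (rewrite !newton_rem_S; unfold Cdiv; ring).
    assert (T := derivC_plus _ _ _ _ _ IHN
      (derivC_scal (/ RtoC (INR (S N))) _ _ _ (derivC_fdiff_powneg x p (S N) z Hz))).
    refine (derivC_ext _ _ _ _ _ T). intro t. rewrite !newton_rem_S. unfold Cdiv. ring.
Qed.

(** Since [W_N (z^-p)] has derivative [- p W_N (z^-(p+1))], the product rule and
    [newton_rem_succ] leave only the last difference. *)
Lemma derivC_scaled_rem (x p : C) (N : nat) (z : R) :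
  (0 < z)%R ->
  derivC (fun t => powneg (- p) t * newton_rem x p N t) z
    (p * (powneg (1 - p) z * fdiff x N (powneg (p + 1)) z)).
Proof.
  intro Hz.
  replace (p * (powneg (1 - p) z * fdiff x N (powneg (p + 1)) z)) with
    ((- - p * powneg (- p + 1) z) * newton_rem x p N z
       + powneg (- p) z * (- p * newton_rem x (p + 1) N z)).
  - apply derivC_mult; [now apply derivC_powneg | now apply derivC_newton_rem].
  - rewrite (newton_rem_succ x p N z Hz), (powneg_succ (- p) z Hz).
    replace (1 - p) with (- p + 1) by ring. ring.
Qed.

Lemma is_lim_seq_inv_SS : is_lim_seq (fun i => / INR (S (S i)))%R 0%R.
Proof.
  apply (is_lim_seq_incr_1 (fun n => / INR (S n))%R).
  apply (is_lim_seq_incr_1 (fun n => / INR n)%R).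
  replace (Finite 0) with (Rbar_inv p_infty) by reflexivity.
  apply is_lim_seq_inv; [apply is_lim_seq_INR | discriminate].
Qed.

Lemma inv_prod_telescope (n : nat) :
  (/ (INR (S n) * INR (S (S n))) = / INR (S n) - / INR (S (S n)))%R.
Proof. rewrite (S_INR (S n)). assert (H := lt_0_INR (S n) ltac:(lia)). field. lra. Qed.

Lemma sum_inv_prod (N : nat) :
  @eq R (sum_n (fun n => / (INR (S n) * INR (S (S n))))%R N) (1 - / INR (S (S N)))%R.
Proof.
  induction N.
  - rewrite sum_O. simpl. field.
  - rewrite sum_n_R_S, IHN, inv_prod_telescope. ring.
Qed.

Lemma ex_series_inv_prod : ex_series (fun n => / (INR (S n) * INR (S (S n))))%R.
Proof.
  exists 1%R. change (is_lim_seq (sum_n (fun n => / (INR (S n) * INR (S (S n))))%R) 1%R).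
  apply is_lim_seq_ext with (fun N => (1 - / INR (S (S N)))%R).
  { intro N; now rewrite sum_inv_prod. }
  replace (Finite 1) with (Finite (1 - 0)) by (f_equal; ring).
  apply is_lim_seq_minus'; [apply is_lim_seq_const|].
  exact is_lim_seq_inv_SS.
Qed.

(** The binomial bound with [j = 1] is taken at [z - 1], and [z <= 2 (z - 1)]
    makes the two powers comparable. *)
Lemma scaled_fdiff_bound (x : C) (Hx : (Cmod (1 - x) < 1)%R) (p : C) :
  (0 < Re p)%R -> exists K, (0 <= K)%R /\ forall n z, (2 <= z)%R ->
    (Cmod (powneg (- p) z * fdiff x n (powneg p) z) <= K * / INR (S n))%R.
Proof.
  intro Hp. destruct (fdiff_powneg_dominated p Hp) as [K [HK0 HK]].
  destruct (rho_pos x Hx) as [Hr _]. set (r := (1 - Cmod (1 - x))%R) in *.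
  set (q := Re p) in *.
  exists (K * exp (q * ln 2) / r)%R. split.
  { apply Rmult_le_pos; [|now apply Rlt_le, Rinv_0_lt_compat].
    apply Rmult_le_pos; [exact HK0 | apply Rlt_le, exp_pos]. }
  intros n z Hz.
  specialize (HK x n 1%nat (z - 1)%R ltac:(lra) ltac:(lra)). fold r in HK.
  replace (z - 1 + INR 1)%R with z in HK by (simpl; ring).
  replace (rising n 1) with (INR (S n)) in HK
    by (simpl rising; replace (n + 1)%nat with (S n) by lia; ring).
  simpl fact in HK. rewrite pow_1 in HK. simpl (INR 1) in HK. rewrite Rmult_1_l in HK.
  rewrite Cmod_mult, Cmod_powneg. replace (Re (- p)) with (- q)%R by reflexivity.
  assert (Hs := lt_0_INR (S n) ltac:(lia)).
  assert (E : (rpowneg (- q) z * rpowneg q (z - 1) <= exp (q * ln 2))%R).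
  { unfold rpowneg. rewrite <- exp_plus. apply exp_mono.
    assert (T := ln_le z (2 * (z - 1)) ltac:(lra) ltac:(lra)).
    rewrite ln_mult in T by lra. nra. }
  set (f := Cmod (fdiff x n (powneg p) z)) in *. set (s := INR (S n)) in *.
  assert (P := rpowneg_pos (- q) z).
  apply Rmult_le_reg_l with (s * r)%R; [now apply Rmult_lt_0_compat|].
  replace (s * r * (K * exp (q * ln 2) / r * / s))%R with (K * exp (q * ln 2))%R by (field; lra).
  apply Rle_trans with (rpowneg (- q) z * (K * rpowneg q (z - 1)))%R; nra.
Qed.

Lemma scaled_rem_bound (x : C) (Hx : (Cmod (1 - x) < 1)%R) (p : C) :
  (0 < Re p)%R -> exists K, forall N z, (2 <= z)%R ->
    (Cmod (powneg (- p) z * newton_rem x p N z) <= K)%R.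
Proof.
  intro Hp. destruct (scaled_fdiff_bound x Hx p Hp) as [K [HK0 HK]].
  exists (Cmod (Clog x) + Cmod p + K)%R. intros N z Hz.
  enough (H : (Cmod (powneg (- p) z * newton_rem x p N z)
     <= Cmod (Clog x) + Cmod p + K * (1 - / INR (S N)))%R).
  { assert (T := Rinv_0_lt_compat _ (lt_0_INR (S N) ltac:(lia))). nra. }
  induction N.
  - simpl newton_rem. simpl INR.
    replace (powneg (- p) z * (Clog x * powneg p z - p * powneg (p + 1) z)) with
      (Clog x * (powneg (- p) z * powneg p z) + - (p * (powneg (- p) z * powneg (p + 1) z))) by ring.
    rewrite powneg_opp, <- powneg_plus. replace (- p + (p + 1)) with (RtoC 1) by ring.
    rewrite Cmult_1_r. eapply Rle_trans; [apply Cmod_triangle|].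
    rewrite Cmod_opp, Cmod_mult, Cmod_powneg. simpl Re.
    assert (T := rpowneg_le_1 1 z ltac:(lra) ltac:(lra)). assert (T2 := Cmod_ge_0 p).
    rewrite Rinv_1. nra.
  - rewrite newton_rem_S.
    replace (powneg (- p) z * (newton_rem x p N z + fdiff x (S N) (powneg p) z / RtoC (INR (S N)))) with
      (powneg (- p) z * newton_rem x p N z + (powneg (- p) z * fdiff x (S N) (powneg p) z) / RtoC (INR (S N)))
      by (unfold Cdiv; ring).
    eapply Rle_trans; [apply Cmod_triangle|].
    rewrite Cmod_div, Cmod_R, (Rabs_pos_eq (INR (S N))) by (apply INR_S_neq_0 || apply pos_INR).
    specialize (HK (S N) z Hz). assert (T := inv_prod_telescope N).
    assert (Hs := Rinv_0_lt_compat _ (lt_0_INR (S N) ltac:(lia))).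
    assert (G : (Cmod (powneg (- p) z * fdiff x (S N) (powneg p) z) / INR (S N) <= K * (/ INR (S N) - / INR (S (S N))))%R).
    { rewrite <- T, Rinv_mult. unfold Rdiv.
      replace (K * (/ INR (S N) * / INR (S (S N))))%R with (K * / INR (S (S N)) * / INR (S N))%R by ring.
      apply Rmult_le_compat_r; lra. }
    lra.
Qed.

(** For [z >= 2] this is [scaled_rem_bound]; a smaller [z] is compared with
    [z + 1] by means of [derivC_scaled_rem]. *)
Lemma newton_rem_bounded (x : C) (Hx : (Cmod (1 - x) < 1)%R) (p : C) :
  (0 < Re p)%R -> exists K, forall N z, (1 <= z)%R -> (Cmod (newton_rem x p N z) <= K)%R.
Proof.
  intro Hp. destruct (scaled_rem_bound x Hx p Hp) as [K HK].
  destruct (fdiff_powneg_dominated (p + 1)) as [K' [HK0' HK']]; [simpl; unfold Re in Hp; lra|].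
  exists (K + Cmod p * K')%R. intros N z Hz.
  assert (H : (Cmod (powneg (- p) z * newton_rem x p N z) <= K + Cmod p * K')%R).
  { assert (D : (Cmod (powneg (- p) z * newton_rem x p N z -
       powneg (- p) (z + 1)%R * newton_rem x p N (z + 1)%R) <= (Cmod p * K') * (z + 1 - z))%R).
    { apply (mean_value_bound (fun t => powneg (- p) t * newton_rem x p N t)
        (fun t => p * (powneg (1 - p) t * fdiff x N (powneg (p + 1)) t))); [lra| |].
      - intros t Ht. apply derivC_scaled_rem. lra.
      - intros t Ht. rewrite !Cmod_mult. apply Rmult_le_compat_l; [apply Cmod_ge_0|].
        specialize (HK' x N 0%nat t ltac:(lra) ltac:(lra)).
        simpl in HK'. rewrite !Rmult_1_l, Rplus_0_r in HK'.
        rewrite Cmod_powneg. assert (P := rpowneg_pos (Re (1 - p)) t).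
        apply Rle_trans with (rpowneg (Re (1 - p)) t * (K' * rpowneg (fst p + 1) t))%R;
          [apply Rmult_le_compat_l; lra|].
        replace (rpowneg (Re (1 - p)) t * (K' * rpowneg (fst p + 1) t))%R with
          (K' * (rpowneg (Re (1 - p)) t * rpowneg (fst p + 1) t))%R by ring.
        rewrite <- rpowneg_plus. rewrite <- (Rmult_1_r K') at 2.
        apply Rmult_le_compat_l; [exact HK0'|]. apply rpowneg_le_1; [unfold Re; simpl|]; lra. }
    specialize (HK N (z + 1)%R ltac:(lra)).
    replace (powneg (- p) z * newton_rem x p N z) with
      ((powneg (- p) z * newton_rem x p N z - powneg (- p) (z + 1)%R * newton_rem x p N (z + 1)%R)
       + powneg (- p) (z + 1)%R * newton_rem x p N (z + 1)%R) by ring.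
    eapply Rle_trans; [apply Cmod_triangle|]. lra. }
  rewrite Cmod_mult, Cmod_powneg in H.
  assert (T : (1 <= rpowneg (Re (- p)) z)%R).
  { unfold rpowneg. rewrite <- exp_0 at 1. apply exp_mono. simpl. unfold Re in Hp.
    assert (L := ln_le 1 z ltac:(lra) Hz). rewrite ln_1 in L. nra. }
  assert (T2 := Cmod_ge_0 (newton_rem x p N z)). nra.
Qed.

Lemma scaled_fdiff_limit (x p : C) (n k : nat) :
  (0 < Re p)%R ->
  Clim (fun i => powneg (- p) (INR (S (S i))) * fdiff x n (powneg p) (INR (S (S i)) + INR k)%R)
    ((1 - x) ^ n).
Proof.
  intro Hp. revert k. induction n; intro k.
  - change (Clim (fun i => powneg (- p) (INR (S (S i))) * powneg p (INR (S (S i)) + INR k)%R) 1).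
    apply Clim_squeeze with (fun i => INR k * Cmod p * / INR (S (S i)))%R.
    + intro i. assert (Hz := lt_0_INR (S (S i)) ltac:(lia)). set (z := INR (S (S i))) in *.
      assert (Hk := pos_INR k).
      replace (powneg (- p) z * powneg p (z + INR k)%R - 1) with
        (- (powneg (- p) z * (powneg p z - powneg p (z + INR k)%R)))
        by (rewrite <- (powneg_opp p z); ring).
      rewrite Cmod_opp, Cmod_mult, Cmod_powneg.
      assert (D : (Cmod (powneg p z - powneg p (z + INR k)%R) <= (Cmod p * rpowneg (Re p + 1) z) * (z + INR k - z))%R).
      { apply (mean_value_bound _ (fun t => - p * powneg (p + 1) t)); [lra| |].
        - intros t Ht. apply derivC_powneg; lra.
        - intros t Ht. rewrite Cmod_mult, Cmod_opp, Cmod_powneg.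
          apply Rmult_le_compat_l; [apply Cmod_ge_0|]. apply rpowneg_decr; lra. }
      eapply Rle_trans; [apply Rmult_le_compat_l; [apply Rlt_le, rpowneg_pos | exact D]|].
      right.
      replace (rpowneg (Re (- p)) z * (Cmod p * rpowneg (Re p + 1) z * (z + INR k - z)))%R
        with (INR k * Cmod p * (rpowneg (Re (- p)) z * rpowneg (Re p + 1) z))%R by ring.
      rewrite <- rpowneg_plus. f_equal.
      replace (Re (- p) + (Re p + 1))%R with 1%R by (unfold Re; simpl; ring).
      assert (E := rpowneg_succ 0 z Hz). rewrite rpowneg_0, Rplus_0_l in E.
      apply Rmult_eq_reg_l with z; [|lra]. rewrite <- E. field. lra.
    + replace 0%R with (INR k * Cmod p * 0)%R by ring.
      apply is_lim_seq_mult'; [apply is_lim_seq_const|].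
      exact is_lim_seq_inv_SS.
  - replace ((1 - x) ^ S n) with ((1 - x) ^ n + - x * (1 - x) ^ n) by (rewrite Cpow_S; ring).
    eapply Clim_ext; [|apply Clim_plus; [apply (IHn k) | apply Clim_scal; apply (IHn (S k))]].
    intro i. cbv beta. rewrite fdiff_S, (S_INR k).
    replace (INR (S (S i)) + (INR k + 1))%R with (INR (S (S i)) + INR k + 1)%R by ring. ring.
Qed.

Lemma scaled_rem_expand (x p : C) (N : nat) (z : R) :
  powneg (- p) z * newton_rem x p (S N) z =
  powneg (- p) z * newton_rem x p 0 z
  + sum_n (fun n => powneg (- p) z * fdiff x (S n) (powneg p) z / RtoC (INR (S n))) N.
Proof.
  induction N.
  - rewrite sum_O, newton_rem_S. unfold Cdiv. ring.
  - rewrite (newton_rem_S x p (S N)), Cmult_plus_distr_l, IHN, sum_n_C_S. unfold Cdiv. ring.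
Qed.

(** As [z] tends to infinity [z^p (1 - x E)^n z^-p] tends to [(1 - x)^n]. By
    dominated convergence in [n] the limit of the scaled remainder is
    [log x + sum_n (1 - x)^n / n = 0]. *)
Lemma scaled_rem_small (x : C) (Hx : (Cmod (1 - x) < 1)%R) (p : C) (z0 eps : R) :
  (0 < Re p)%R -> (0 < eps)%R ->
  exists Y N0, (z0 <= Y)%R /\ (1 <= Y)%R /\
    forall N, (N0 <= N)%nat -> (Cmod (powneg (- p) Y * newton_rem x p N Y) <= eps)%R.
Proof.
  intros Hp Heps.
  destruct (scaled_fdiff_bound x Hx p Hp) as [K [HK0 HK]].
  set (Y := fun i => INR (S (S i))).
  assert (HY : forall i, (2 <= Y i)%R).
  { intro i. unfold Y. rewrite !S_INR. assert (T := pos_INR i). lra. }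
  set (f := fun i n => powneg (- p) (Y i) * fdiff x (S n) (powneg p) (Y i) / RtoC (INR (S n))).
  set (f0 := fun n => (1 - x) ^ S n / RtoC (INR (S n))).
  set (g := fun n => (K * / (INR (S n) * INR (S (S n))))%R).
  assert (Hg : ex_series g) by (apply (ex_series_scal (V := R_NormedModule) K (fun n => / (INR (S n) * INR (S (S n))))%R), ex_series_inv_prod).
  assert (Hfg : forall i n, (Cmod (f i n) <= g n)%R).
  { intros i n. unfold f, g. rewrite Cmod_div, Cmod_R, (Rabs_pos_eq (INR (S n)))
      by (apply INR_S_neq_0 || apply pos_INR).
    rewrite Rinv_mult. specialize (HK (S n) (Y i) (HY i)).
    assert (Hs := Rinv_0_lt_compat _ (lt_0_INR (S n) ltac:(lia))).
    unfold Rdiv. replace (K * (/ INR (S n) * / INR (S (S n))))%R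
      with (K * / INR (S (S n)) * / INR (S n))%R by ring.
    apply Rmult_le_compat_r; lra. }
  destruct (tannery f f0 (fun i => (Series (fun k => Re (f i k)), Series (fun k => Im (f i k)))) g)
    as [l [Hl HL]].
  - exact Hfg.
  - exact Hg.
  - intro i. apply Cseries_dominated with g; auto.
  - intro n. unfold f, f0, Cdiv.
    apply Clim_mult; [|apply Clim_const].
    eapply Clim_ext; [|apply (scaled_fdiff_limit x p (S n) 0 Hp)].
    intro i. cbv beta. change (INR 0) with 0%R. rewrite Rplus_0_r. reflexivity.
  - set (L := fun i => (Series (fun k => Re (f i k)), Series (fun k => Im (f i k))) : C) in HL.
    assert (El : l = - Clog x).
    { assert (T := Clog_series (1 - x) Hx). replace (1 - (1 - x)) with x in T by ring.
      apply Cseries_Clim in Hl. apply Cseries_Clim in T. exact (Clim_unique _ _ _ Hl T). }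
    assert (HB : Clim (fun i => powneg (- p) (Y i) * newton_rem x p 0 (Y i) + L i) 0).
    { replace (RtoC 0) with (Clog x + - p * 0 + l) by (rewrite El; ring).
      apply Clim_plus; [|exact HL].
      apply Clim_ext with (fun i => Clog x + - p * powneg 1 (Y i)).
      - intro i. simpl newton_rem.
        replace (powneg (- p) (Y i) * (Clog x * powneg p (Y i) - p * powneg (p + 1) (Y i))) with
         (Clog x * (powneg (- p) (Y i) * powneg p (Y i)) + - p * (powneg (- p) (Y i) * powneg (p + 1) (Y i))) by ring.
        rewrite powneg_opp, <- powneg_plus. replace (- p + (p + 1)) with (RtoC 1) by ring. ring.
      - apply Clim_plus; [apply Clim_const|]. apply Clim_scal.
        apply Clim_squeeze with (fun i => / INR (S (S i)))%R.
        + intro i. replace (powneg 1 (Y i) - 0) with (powneg 1 (Y i)) by ring.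
          rewrite Cmod_powneg. simpl Re. right.
          assert (Hz : (0 < Y i)%R) by (specialize (HY i); lra).
          assert (E := rpowneg_succ 0 _ Hz). rewrite rpowneg_0, Rplus_0_l in E.
          apply Rmult_eq_reg_l with (Y i); [|lra]. rewrite <- E. unfold Y in *. field. lra.
        + exact is_lim_seq_inv_SS. }
    assert (He : (0 < eps / 2)%R) by lra.
    rewrite Clim_eps in HB. destruct (HB (mkposreal _ He)) as [i0 Hi0].
    destruct (INR_unbounded z0) as [i1 Hi1].
    set (i := Nat.max i0 i1). specialize (Hi0 i (Nat.le_max_l _ _)). simpl in Hi0.
    assert (HS : Cseries (f i) (L i)) by (apply Cseries_dominated with g; auto).
    apply Cseries_Clim in HS. rewrite Clim_eps in HS.
    destruct (HS (mkposreal _ He)) as [N1 HN1]. simpl in HN1.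
    exists (Y i), (S N1). split; [|split].
    + unfold Y. rewrite !S_INR. assert (T := le_INR _ _ (Nat.le_max_r i0 i1)). fold i in T. lra.
    + specialize (HY i). lra.
    + intros N HN. destruct N as [|N]; [lia|].
      rewrite scaled_rem_expand. fold (f i). specialize (HN1 N ltac:(lia)).
      replace (powneg (- p) (Y i) * newton_rem x p 0 (Y i) + sum_n (f i) N) with
        ((powneg (- p) (Y i) * newton_rem x p 0 (Y i) + L i - 0) + (sum_n (f i) N - L i)) by ring.
      eapply Rle_trans; [apply Cmod_triangle|]. simpl newton_rem in *. lra.
Qed.

(** Between [z] and a distant [Y] the scaled remainder varies little for large
    [N], by [derivC_scaled_rem] and the decay of the last difference; at [Y] it
    is small. *)
Lemma newton_rem_vanish_pos (x : C) (Hx : (Cmod (1 - x) < 1)%R) (p : C) (z : R) :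
  (0 < Re p)%R -> (1 <= z)%R -> Clim (fun N => newton_rem x p N z) 0.
Proof.
  intros Hp Hz.
  apply Clim_ext with (fun N => powneg p z * (powneg (- p) z * newton_rem x p N z)).
  { intro N. rewrite Cmult_assoc, (Cmult_comm (powneg p z)), powneg_opp. ring. }
  replace (RtoC 0) with (powneg p z * 0) by ring. apply Clim_scal.
  apply Clim_eps. intro eps.
  assert (He : (0 < eps / 3)%R) by (destruct eps; simpl; lra).
  destruct (scaled_rem_small x Hx p z _ Hp He) as (Y & N0 & HzY & HY & HN0).
  set (B := exp (Rabs (Re (1 - p)) * (Rabs (ln 1) + Rabs (ln Y)))).
  (* the summand 1 keeps the divisor positive *)
  set (D := (Cmod p * B * (Y - z) + 1)%R).
  assert (HB : (0 < B)%R) by apply exp_pos.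
  assert (HD : (0 < D)%R).
  { unfold D. assert (T := Cmod_ge_0 p).
    assert (0 <= Cmod p * B * (Y - z))%R by (apply Rmult_le_pos; nra). lra. }
  assert (HeD : (0 < eps / 3 / D)%R) by (apply Rdiv_lt_0_compat; lra).
  destruct (fdiff_powneg_vanish_unif x Hx (p + 1) Y _ HeD) as [N1 HN1].
  exists (Nat.max N0 N1). intros N HN.
  specialize (HN0 N ltac:(lia)).
  assert (M : (Cmod (powneg (- p) z * newton_rem x p N z - powneg (- p) Y * newton_rem x p N Y)
     <= (Cmod p * (B * (eps / 3 / D))) * (Y - z))%R).
  { apply (mean_value_bound (fun t => powneg (- p) t * newton_rem x p N t)
        (fun t => p * (powneg (1 - p) t * fdiff x N (powneg (p + 1)) t))); [lra| |].
    - intros t Ht. apply derivC_scaled_rem. lra.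
    - intros t Ht. rewrite !Cmod_mult. apply Rmult_le_compat_l; [apply Cmod_ge_0|].
      apply Rmult_le_compat; [apply Cmod_ge_0 | apply Cmod_ge_0 | |apply HN1; [lia|lra]].
      rewrite Cmod_powneg. apply rpowneg_bound; lra. }
  assert (M2 : ((Cmod p * (B * (eps / 3 / D))) * (Y - z) <= eps / 3)%R).
  { replace ((Cmod p * (B * (eps / 3 / D))) * (Y - z))%R with ((D - 1) * (eps / 3 / D))%R
      by (unfold D; ring).
    apply Rle_trans with (D * (eps / 3 / D))%R; [nra | right; field; lra]. }
  replace (powneg (- p) z * newton_rem x p N z - 0) with
    ((powneg (- p) z * newton_rem x p N z - powneg (- p) Y * newton_rem x p N Y)
      + powneg (- p) Y * newton_rem x p N Y) by ring.
  eapply Rle_lt_trans; [apply Cmod_triangle|]. lra.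
Qed.

Lemma newton_rem_vanish (x : C) (Hx : (Cmod (1 - x) < 1)%R) (p : C) (z : R) :
  (1 <= z)%R -> Clim (fun N => newton_rem x p N z) 0.
Proof.
  intro Hz. revert p. apply exponent_ind.
  - intros p Hp. now apply newton_rem_vanish_pos.
  - intros p IH.
    apply Clim_ext with (fun N => z * newton_rem x (p + 1) N z + fdiff x N (powneg (p + 1)) z).
    { intro N. rewrite <- newton_rem_succ; [reflexivity | lra]. }
    replace (RtoC 0) with (RtoC z * 0 + 0) by ring.
    apply Clim_plus; [now apply Clim_scal | now apply fdiff_powneg_vanish].
Qed.

Lemma fdiff_powneg_poly (x : C) (Hx : (Cmod (1 - x) < 1)%R) (p : C) :
  exists A K, (0 <= K)%R /\ forall n z, (1 <= z)%R ->
    (Cmod (fdiff x n (powneg p) z) <= K * (1 + z) ^ A)%R.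
Proof.
  destruct (fdiff_powneg_bound x Hx p) as (q & A & H). destruct (H 0%nat) as [K HK].
  destruct (INR_unbounded (- q)) as [m Hm].
  exists (A + m)%nat, (Rabs K). split; [apply Rabs_pos|].
  intros n z Hz. specialize (HK n z ltac:(lra)). simpl in HK.
  rewrite Rplus_0_r, Rmult_1_l in HK. eapply Rle_trans; [exact HK|].
  assert (E : (rpowneg q z <= (1 + z) ^ m)%R).
  { apply Rle_trans with (z ^ m)%R; [|apply pow_incr; lra].
    rewrite <- Rpower_pow by lra. unfold rpowneg, Rpower. apply exp_mono.
    assert (L := ln_le 1 z ltac:(lra) Hz). rewrite ln_1 in L. nra. }
  rewrite pow_add. assert (P := rpowneg_pos q z). assert (P2 := pow_lt (1 + z) A ltac:(lra)).
  apply Rle_trans with (Rabs K * ((1 + z) ^ A * rpowneg q z))%R.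
  - apply Rmult_le_compat_r; [nra | apply Rle_abs].
  - apply Rmult_le_compat_l; [apply Rabs_pos|]. apply Rmult_le_compat_l; lra.
Qed.

Lemma newton_rem_poly (x : C) (Hx : (Cmod (1 - x) < 1)%R) (p : C) :
  exists A K, (0 <= K)%R /\ forall N z, (1 <= z)%R ->
    (Cmod (newton_rem x p N z) <= K * (1 + z) ^ A)%R.
Proof.
  revert p. apply exponent_ind.
  - intros p Hp. destruct (newton_rem_bounded x Hx p Hp) as [K HK]. exists 0%nat, (Rabs K).
    split; [apply Rabs_pos|]. intros N z Hz. simpl. rewrite Rmult_1_r.
    eapply Rle_trans; [now apply HK | apply Rle_abs].
  - intros p (A & K & HK0 & HK). destruct (fdiff_powneg_poly x Hx (p + 1)) as (A' & K' & HK0' & HK').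
    exists (S A + A')%nat, (K + K')%R. split; [lra|]. intros N z Hz.
    rewrite newton_rem_succ by lra. eapply Rle_trans; [apply Cmod_triangle|].
    rewrite Cmod_mult, Cmod_R, Rabs_pos_eq by lra.
    specialize (HK N z Hz). specialize (HK' N z Hz).
    assert (H1 := pow_R1_Rle (1 + z) (S A) ltac:(lra)).
    assert (H2 := pow_R1_Rle (1 + z) A' ltac:(lra)).
    assert (H3 := pow_R1_Rle (1 + z) A ltac:(lra)).
    rewrite pow_add. rewrite Rmult_plus_distr_r. apply Rplus_le_compat.
    + apply Rle_trans with ((1 + z) * (K * (1 + z) ^ A))%R.
      * apply Rmult_le_compat; try lra. apply Cmod_ge_0.
      * replace ((1 + z) * (K * (1 + z) ^ A))%R with (K * (1 + z) ^ S A)%R by (simpl; ring).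
        apply Rmult_le_compat_l; [exact HK0|]. nra.
    + eapply Rle_trans; [exact HK'|]. apply Rmult_le_compat_l; [exact HK0'|]. nra.
Qed.

(** * The inner sum as a weighted difference *)

Lemma sum_n_C_shift (a : nat -> C) (n : nat) :
  sum_n a (S n) = a 0%nat + sum_n (fun k => a (S k)) n.
Proof.
  induction n.
  - rewrite sum_n_C_S, !sum_O. reflexivity.
  - rewrite (sum_n_C_S a (S n)), IHn, (sum_n_C_S (fun k => a (S k))). Cring.
Qed.

Lemma sum_n_C_plus (a b : nat -> C) (n : nat) :
  sum_n (fun k => a k + b k) n = sum_n a n + sum_n b n.
Proof. exact (sum_n_plus a b n). Qed.

Lemma sum_n_C_mult_l (c : C) (a : nat -> C) (n : nat) :
  sum_n (fun k => c * a k) n = c * sum_n a n.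
Proof.
  induction n; [now rewrite !sum_O|]. rewrite !sum_n_C_S, IHn. Cring.
Qed.

Lemma Binomial_C_0 (n : nat) : Binomial.C n 0 = 1%R.
Proof.
  unfold Binomial.C. rewrite Nat.sub_0_r. simpl (fact 0). simpl (INR 1).
  field. apply INR_fact_neq_0.
Qed.

Lemma Binomial_C_diag (n : nat) : Binomial.C n n = 1%R.
Proof.
  unfold Binomial.C. rewrite Nat.sub_diag. simpl (fact 0). simpl (INR 1).
  field. apply INR_fact_neq_0.
Qed.

Lemma fdiff_binomial (x : C) (n : nat) (f : R -> C) (z : R) :
  fdiff x n f z =
  sum_n (fun k => RtoC (Binomial.C n k) * ((-1) ^ k * x ^ k) * f (z + INR k)%R) n.
Proof.
  revert z. induction n; intro z.
  - rewrite sum_O. simpl. rewrite Binomial_C_0, Rplus_0_r. ring.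
  - rewrite fdiff_S, (IHn z), (IHn (z + 1)%R).
    rewrite (sum_n_C_shift (fun k => RtoC (Binomial.C (S n) k) * _ * _)).
    set (u := fun k => ((-1) ^ k * x ^ k) * f (z + INR k)%R).
    assert (Hu : forall k, - x * ((-1) ^ k * x ^ k * f (z + 1 + INR k)%R) = u (S k)).
    { intro k. unfold u. rewrite S_INR, !Cpow_S.
      replace (z + (INR k + 1))%R with (z + 1 + INR k)%R by ring. ring. }
    replace (sum_n (fun k => RtoC (Binomial.C n k) * ((-1) ^ k * x ^ k) * f (z + INR k)%R) n)
      with (sum_n (fun k => RtoC (Binomial.C n k) * u k) n)
      by (apply sum_n_ext; intro k; unfold u; apply Cmult_assoc).
    assert (E2 : - (x * sum_n (fun k => RtoC (Binomial.C n k) * ((-1) ^ k * x ^ k) * f (z + 1 + INR k)%R) n)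
      = sum_n (fun k => RtoC (Binomial.C n k) * u (S k)) n).
    { replace (- (x * sum_n (fun k => RtoC (Binomial.C n k) * ((-1) ^ k * x ^ k) * f (z + 1 + INR k)%R) n))
       with (- x * sum_n (fun k => RtoC (Binomial.C n k) * ((-1) ^ k * x ^ k) * f (z + 1 + INR k)%R) n) by ring.
      rewrite <- sum_n_C_mult_l. apply sum_n_ext. intro k. rewrite <- Hu. 
      Cring. }
    unfold Cminus at 1. rewrite E2.
    replace (sum_n (fun k => RtoC (Binomial.C (S n) (S k)) * ((-1) ^ S k * x ^ S k) * f (z + INR (S k))%R) n)
      with (sum_n (fun k => RtoC (Binomial.C (S n) (S k)) * u (S k)) n)
      by (apply sum_n_ext; intro k; unfold u; apply Cmult_assoc).
    replace (RtoC (Binomial.C (S n) 0) * ((-1) ^ 0 * x ^ 0) * f (z + INR 0)%R) with (u 0%nat)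
      by (unfold u; rewrite Binomial_C_0; ring).
    clearbody u. clear.
    destruct n as [|n].
    + rewrite !sum_O, !Binomial_C_diag. Cring.
    + rewrite (sum_n_C_S (fun k => RtoC (Binomial.C (S (S n)) (S k)) * u (S k))).
      rewrite (sum_n_C_S (fun k => RtoC (Binomial.C (S n) k) * u (S k))).
      rewrite (sum_n_C_shift (fun k => RtoC (Binomial.C (S n) k) * u k)).
      rewrite !Binomial_C_diag, Binomial_C_0.
      replace (sum_n (fun k => RtoC (Binomial.C (S (S n)) (S k)) * u (S k)) n) with
        (sum_n (fun k => RtoC (Binomial.C (S n) k) * u (S k)) n
          + sum_n (fun k => RtoC (Binomial.C (S n) (S k)) * u (S k)) n).
      * Cring.
      * rewrite <- sum_n_C_plus. apply sum_n_ext_loc. intros k Hk.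
        rewrite <- (pascal (S n) k) by lia. rewrite RtoC_plus.
        rewrite Cmult_plus_distr_r. reflexivity.
Qed.

Lemma npow_powneg (n : nat) (s : C) : / npow n s = powneg s (INR n).
Proof.
  assert (E : npow n s * powneg s (INR n) = 1).
  { unfold npow, powneg. rewrite <- Cexp_plus, <- Cexp_0. f_equal. ring. }
  assert (Hn : npow n s <> 0).
  { intro H. rewrite H, Cmult_0_l in E. apply RtoC_inj in E. lra. }
  replace (powneg s (INR n)) with (/ npow n s * (npow n s * powneg s (INR n))) by (field; exact Hn).
  rewrite E. ring.
Qed.

(** The factor [z] in [z * z^-(s+1)] produces the value [0] at [z = 0], which
    removes the term [k = 0] of the binomial expansion. *)
Lemma inner_sum_fdiff (s x : C) (n : nat) :
  inner_sum s x n = fdiff x n (fun z => RtoC z * powneg (s + 1) z) 0.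
Proof.
  rewrite fdiff_binomial. unfold sum_n, inner_sum.
  rewrite (sum_Sn_m _ 0 n) by lia.
  replace (RtoC (Binomial.C n 0) * ((-1) ^ 0 * x ^ 0) * (RtoC (0 + INR 0) * powneg (s + 1) (0 + INR 0)))
    with (RtoC 0) by (simpl; rewrite Rplus_0_l; ring).
  symmetry. etransitivity; [apply (plus_zero_l (G := C_AbelianMonoid))|].
  apply sum_n_m_ext_loc. intros k Hk.
  rewrite Rplus_0_l, <- powneg_succ by (apply lt_0_INR; lia).
  rewrite <- npow_powneg. unfold Cdiv. 
  symmetry. rewrite !Cmult_assoc. reflexivity.
Qed.

Lemma inner_sum_last (s x : C) (n : nat) :
  inner_sum s x (S n) = - (RtoC (INR (S n)) * x * fdiff x n (powneg (s + 1)) 1).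
Proof.
  rewrite inner_sum_fdiff, fdiff_mul_id, Rplus_0_l. ring.
Qed.

Lemma inner_sum_partial (s x : C) (n : nat) :
  inner_sum s x (S n) = - (x * sum_n (fun j => fdiff x j (powneg s) 1) n).
Proof.
  rewrite inner_sum_fdiff.
  assert (H : forall m, fdiff x m (fun z => RtoC z * powneg (s + 1) z) (0 + 1) = fdiff x m (powneg s) 1).
  { intro m. rewrite Rplus_0_l. apply fdiff_ext_pos; [lra|].
    intros y Hy. symmetry. now apply powneg_succ. }
  induction n.
  - rewrite fdiff_S, H, sum_O. simpl fdiff. ring.
  - rewrite fdiff_S, IHn, H, sum_n_C_S. ring.
Qed.

(** * The identity for |x| < 1 and |1 - x| < 1 *)

Lemma Cseries_plus (a b : nat -> C) (l m : C) :
  Cseries a l -> Cseries b m -> Cseries (fun n => a n + b n) (l + m).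
Proof. exact (is_series_plus a b l m). Qed.

Lemma Cseries_scal (c : C) (a : nat -> C) (l : C) :
  Cseries a l -> Cseries (fun n => c * a n) (c * l).
Proof. exact (is_series_scal c a l). Qed.

Lemma Cseries_ext (a b : nat -> C) (l : C) :
  (forall n, a n = b n) -> Cseries a l -> Cseries b l.
Proof. exact (is_series_ext a b l). Qed.

Lemma ex_series_poly_geom (A : nat) (r : R) :
  (0 < r < 1)%R -> ex_series (fun m => (1 + INR (S m)) ^ A * r ^ S m)%R.
Proof.
  intro Hr.
  assert (HA : is_lim_seq (fun m => (1 + / INR (S (S m))) ^ A)%R 1%R).
  { induction A; [apply is_lim_seq_const|].
    replace (Finite 1) with (Finite ((1 + 0) * 1)) by (f_equal; ring).
    apply (is_lim_seq_mult' (fun m => 1 + / INR (S (S m)))%R); [|exact IHA].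
    apply is_lim_seq_plus'; [apply is_lim_seq_const | apply is_lim_seq_inv_SS]. }
  set (a := fun m => ((1 + INR (S m)) ^ A * r ^ S m)%R).
  assert (Hpos : forall m, (0 < a m)%R).
  { intro m. unfold a. apply Rmult_lt_0_compat; apply pow_lt; [|lra].
    assert (T := pos_INR (S m)). lra. }
  apply ex_series_ext with (fun m => Rabs (a m)).
  { intro m. apply Rabs_pos_eq. apply Rlt_le, Hpos. }
  apply ex_series_DAlembert with r; [lra | intro m; apply Rgt_not_eq, Hpos |].
  apply is_lim_seq_ext with (fun m => (1 + / INR (S (S m))) ^ A * r)%R.
  - intro m. rewrite Rabs_pos_eq by (apply Rlt_le, Rdiv_lt_0_compat; apply Hpos).
    unfold a. assert (T := pos_INR m).
    replace (1 + / INR (S (S m)))%R with ((1 + INR (S (S m))) / (1 + INR (S m)))%R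
      by (rewrite !S_INR; field; lra).
    unfold Rdiv at 1. rewrite Rpow_mult_distr, pow_inv.
    rewrite <- (tech_pow_Rmult r (S m)). field.
    split; apply pow_nonzero; [lra|]. rewrite S_INR; lra.
  - replace (Finite r) with (Finite (1 * r)) by (f_equal; ring).
    apply is_lim_seq_mult'; [exact HA | apply is_lim_seq_const].
Qed.

Lemma Clim_series_term (a : nat -> C) (g : nat -> R) :
  (forall n, (Cmod (a n) <= g n)%R) -> ex_series g -> Clim a 0.
Proof.
  intros H Hg. apply Clim_squeeze with g; [|now apply ex_series_lim_0].
  intro n. replace (a n - 0) with (a n) by ring. apply H.
Qed.

Lemma polylog_term_powneg (s x : C) (n : nat) :
  polylog_term s x n = x ^ n * powneg s (INR n).
Proof. unfold polylog_term, Cdiv. now rewrite npow_powneg. Qed.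

Lemma polylog_series (s x : C) (g : nat -> R) :
  (forall n, (Cmod (x ^ S n * powneg s (INR (S n))) <= g n)%R) -> ex_series g ->
  Cseries (fun n => x ^ S n * powneg s (INR (S n))) (polylog s x).
Proof.
  intros H Hg. apply Cseries_ext with (fun n => polylog_term s x (S n)).
  { intro n. apply polylog_term_powneg. }
  apply Cseries_dominated with g; [|exact Hg].
  intro n. rewrite polylog_term_powneg. apply H.
Qed.

Definition lhs_term (s x : C) (n : nat) : C :=
  1 / RtoC (INR (S n)) ^ 2 * inner_sum s x (S n).

Definition rhs (s x : C) : C :=
  - (s + 1) * polylog (s + 2) x + Clog x * polylog (s + 1) x.

Lemma Cmod_open_pos (x : C) (Hx : (Cmod (1 - x) < 1)%R) : (0 < Cmod x)%R.
Proof.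
  apply Cmod_gt_0. intro H. rewrite H in Hx.
  replace (1 - 0) with (RtoC 1) in Hx by ring. rewrite Cmod_1 in Hx. lra.
Qed.

Lemma ex_series_poly_Cmod (x : C) (Hx1 : (Cmod x < 1)%R) (Hx : (Cmod (1 - x) < 1)%R) (K : R) (A : nat) :
  ex_series (fun m => K * ((1 + INR (S m)) ^ A * Cmod x ^ S m))%R.
Proof.
  apply (ex_series_scal (V := R_NormedModule) K (fun m => (1 + INR (S m)) ^ A * Cmod x ^ S m)%R).
  apply ex_series_poly_geom. assert (T := Cmod_open_pos x Hx). lra.
Qed.

Lemma INR_S_ge_1 (m : nat) : (1 <= INR (S m))%R.
Proof. rewrite S_INR. assert (T := pos_INR m). lra. Qed.

Lemma Cmod_pow_mult_le (x f : C) (B : R) (m : nat) :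
  (Cmod f <= B)%R -> (Cmod (x ^ S m * f) <= B * Cmod x ^ S m)%R.
Proof.
  intro H. rewrite Cmod_mult, Cmod_pow, Rmult_comm.
  apply Rmult_le_compat_r; [apply pow_le, Cmod_ge_0 | exact H].
Qed.

Lemma polylog_series_open (x : C) (Hx1 : (Cmod x < 1)%R) (Hx : (Cmod (1 - x) < 1)%R) (s : C) :
  Cseries (fun n => x ^ S n * powneg s (INR (S n))) (polylog s x).
Proof.
  destruct (fdiff_powneg_poly x Hx s) as (A & K & HK0 & HK).
  apply polylog_series with (fun m => K * ((1 + INR (S m)) ^ A * Cmod x ^ S m))%R.
  - intro n. rewrite <- Rmult_assoc. apply Cmod_pow_mult_le.
    exact (HK 0%nat _ (INR_S_ge_1 n)).
  - now apply ex_series_poly_Cmod.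
Qed.

(** Multiplied by [x^m], the operator [1 - x E] becomes a plain difference
    in [m]. *)
Lemma fdiff_telescope (x : C) (Hx1 : (Cmod x < 1)%R) (Hx : (Cmod (1 - x) < 1)%R) (p : C) (n : nat) :
  Cseries (fun m => x ^ S m * fdiff x (S n) (powneg p) (INR (S m))) (x * fdiff x n (powneg p) 1).
Proof.
  set (c := fun m => x ^ S m * fdiff x n (powneg p) (INR (S m))).
  assert (Hc : Clim c 0).
  { destruct (fdiff_powneg_poly x Hx p) as (A & K & HK0 & HK).
    apply Clim_series_term with (fun m => K * ((1 + INR (S m)) ^ A * Cmod x ^ S m))%R.
    - intro m. unfold c. rewrite <- Rmult_assoc. apply Cmod_pow_mult_le.
      apply HK, INR_S_ge_1.
    - now apply ex_series_poly_Cmod. }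
  assert (Hs : forall M, sum_n (fun m => x ^ S m * fdiff x (S n) (powneg p) (INR (S m))) M = c 0%nat - c (S M)).
  { assert (E : forall m, x ^ S m * fdiff x (S n) (powneg p) (INR (S m)) = c m - c (S m)).
    { intro m. unfold c. rewrite fdiff_S, (S_INR (S m)), (Cpow_S x (S m)). ring. }
    induction M.
    - rewrite sum_O. apply E.
    - rewrite sum_n_C_S, IHM, E. Cring. }
  apply Cseries_Clim. apply Clim_ext with (fun M => c 0%nat + - (1) * c (S M)).
  { intro M. rewrite Hs. ring. }
  replace (x * fdiff x n (powneg p) 1) with (c 0%nat + - (1) * 0).
  2:{ unfold c. simpl (INR 1). rewrite Cpow_1_r. ring. }
  apply Clim_plus; [apply Clim_const|]. apply Clim_scal.
  exact (proj1 (is_lim_seq_incr_1 (fun m => Cmod (c m - 0)) (Finite 0)) Hc).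
Qed.

Lemma rem_series_step (x : C) (Hx1 : (Cmod x < 1)%R) (Hx : (Cmod (1 - x) < 1)%R) (s : C) (N : nat) (L : C) :
  Cseries (fun m => x ^ S m * newton_rem x (s + 1) N (INR (S m))) L ->
  Cseries (fun m => x ^ S m * newton_rem x (s + 1) (S N) (INR (S m))) (L + - lhs_term s x N).
Proof.
  intro H.
  replace (- lhs_term s x N) with (/ RtoC (INR (S N)) * (x * fdiff x N (powneg (s + 1)) 1)).
  2:{ unfold lhs_term. rewrite inner_sum_last. field. apply INR_S_neq_0. }
  eapply Cseries_ext; [|exact (Cseries_plus _ _ _ _ H (Cseries_scal _ _ _ (fdiff_telescope x Hx1 Hx (s + 1) N)))].
  intro m. cbv beta. rewrite newton_rem_S. unfold Cdiv. ring.
Qed.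

Lemma rem_series (x : C) (Hx1 : (Cmod x < 1)%R) (Hx : (Cmod (1 - x) < 1)%R) (s : C) (N : nat) :
  Cseries (fun m => x ^ S m * newton_rem x (s + 1) (S N) (INR (S m)))
    (rhs s x + - sum_n (lhs_term s x) N).
Proof.
  induction N.
  - rewrite sum_O. apply (rem_series_step x Hx1 Hx).
    unfold rhs. rewrite (Cplus_comm (- (s + 1) * polylog (s + 2) x)).
    eapply Cseries_ext; [|exact (Cseries_plus _ _ _ _
       (Cseries_scal (Clog x) _ _ (polylog_series_open x Hx1 Hx (s + 1)))
       (Cseries_scal (- (s + 1)) _ _ (polylog_series_open x Hx1 Hx (s + 2))))].
    intro m. cbv beta. rewrite newton_rem_0.
    replace (s + 1 + 1) with (s + 2) by (rewrite <- Cplus_assoc, <- RtoC_plus; reflexivity). ring.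
  - rewrite sum_n_C_S.
    replace (rhs s x + - (sum_n (lhs_term s x) N + lhs_term s x (S N))) with
      ((rhs s x + - sum_n (lhs_term s x) N) + - lhs_term s x (S N)) by Cring.
    now apply (rem_series_step x Hx1 Hx).
Qed.

Lemma identity_open (x : C) (Hx1 : (Cmod x < 1)%R) (Hx : (Cmod (1 - x) < 1)%R) (s : C) : Cseries (lhs_term s x) (rhs s x).
Proof.
  destruct (newton_rem_poly x Hx (s + 1)) as (A & K & HK0 & HK).
  destruct (tannery (fun N m => x ^ S m * newton_rem x (s + 1) (S N) (INR (S m))) (fun _ => 0)
    (fun N => rhs s x + - sum_n (lhs_term s x) N)
    (fun m => K * ((1 + INR (S m)) ^ A * Cmod x ^ S m))%R) as [l [Hl HL]].
  - intros N m. rewrite <- Rmult_assoc. apply Cmod_pow_mult_le. apply HK, INR_S_ge_1.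
  - now apply ex_series_poly_Cmod.
  - intro N. now apply rem_series.
  - intro m. replace (RtoC 0) with (x ^ S m * 0) by ring. apply Clim_scal.
    exact (proj1 (is_lim_seq_incr_1 (fun N => Cmod (newton_rem x (s + 1) N (INR (S m)) - 0)) (Finite 0))
      (newton_rem_vanish x Hx (s + 1) _ (INR_S_ge_1 m))).
  - assert (El : @eq C l 0).
    { apply Cseries_Clim in Hl. apply (Clim_unique _ _ _ Hl).
      apply Clim_ext with (fun _ => RtoC 0); [|apply Clim_const].
      intro n. induction n; [now rewrite sum_O | rewrite sum_n_C_S, <- IHn; Cring]. }
    apply Cseries_Clim.
    apply Clim_ext with (fun N => rhs s x + - (1) * (rhs s x + - sum_n (lhs_term s x) N)).
    { intro N. Cring. }
    assert (G := Clim_plus _ _ _ _ (Clim_const (rhs s x)) (Clim_scal (- (1)) _ _ HL)).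
    rewrite El in G. replace (rhs s x + - (1) * 0) with (rhs s x) in G by ring. exact G.
Qed.


(** * Passage to the boundary *)

Lemma rpowneg_telescope (e z : R) :
  (0 < e)%R -> (0 < z)%R -> (e * rpowneg (1 + e) (z + 1) <= rpowneg e z - rpowneg e (z + 1))%R.
Proof.
  intros He Hz.
  assert (H := is_derive_nonneg_incr
    (fun t => - rpowneg e t - e * rpowneg (1 + e) (z + 1) * t)%R
    (fun t => - - (e * rpowneg (e + 1) t) - e * rpowneg (1 + e) (z + 1))%R z (z + 1)%R).
  enough (- rpowneg e z - e * rpowneg (1 + e) (z + 1) * z <=
     - rpowneg e (z + 1) - e * rpowneg (1 + e) (z + 1) * (z + 1))%R by lra.
  apply H; [lra| |].
  - intros t Ht. apply (is_derive_minus (K := R_AbsRing) (V := R_NormedModule)).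
    + apply (is_derive_opp (K := R_AbsRing) (V := R_NormedModule)). apply is_derive_rpowneg; lra.
    + auto_derive; [trivial | ring].
  - intros t Ht. assert (D := rpowneg_decr (1 + e) t (z + 1) ltac:(lra) ltac:(lra)).
    rewrite (Rplus_comm e 1). nra.
Qed.

Lemma ex_series_rpowneg (e : R) :
  (0 < e)%R -> ex_series (fun n => rpowneg (1 + e) (INR (S n))).
Proof.
  intro He.
  assert (H : forall N, (sum_n (fun n => rpowneg (1 + e) (INR (S n))) N <=
     1 + / e * (1 - rpowneg e (INR (S N))))%R).
  { induction N.
    - rewrite sum_O. simpl INR.
      assert (E1 := rpowneg_le_1 (1 + e) 1 ltac:(lra) ltac:(lra)).
      unfold rpowneg at 2. rewrite ln_1, Rmult_0_r, exp_0. lra.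
    - rewrite sum_n_R_S.
      assert (T := rpowneg_telescope e (INR (S N)) He (lt_0_INR (S N) ltac:(lia))).
      rewrite <- (S_INR (S N)) in T.
      assert (Hi := Rinv_0_lt_compat e He).
      assert (T' : (rpowneg (1 + e) (INR (S (S N))) <= / e * (rpowneg e (INR (S N)) - rpowneg e (INR (S (S N)))))%R).
      { apply Rmult_le_reg_l with e; [exact He|]. rewrite <- Rmult_assoc, Rinv_r, Rmult_1_l by lra.
        exact T. }
      lra. }
  apply (ex_finite_lim_seq_incr _ (1 + / e)%R).
  - intro n. rewrite sum_n_R_S.
    assert (P := rpowneg_pos (1 + e) (INR (S (S n)))). 
    rewrite <- Rplus_0_r at 1. apply Rplus_le_compat; [apply Rle_refl | lra].
  - intro n. eapply Rle_trans; [apply H|].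
    assert (Hi := Rinv_0_lt_compat e He). assert (P := rpowneg_pos e (INR (S n))). nra.
Qed.

Lemma sum_n_R_const (c : R) (n : nat) : sum_n (fun _ => c) n = (INR (S n) * c)%R.
Proof. now rewrite sum_n_const. Qed.

(** The inner sum is [- x] times the sum of the first [n] operators
    [(1 - x E)^j] applied to [z^-s] at [1].  Termwise bounds give only [O(n)],
    which is not enough.  At [1 + d] the sum telescopes and is of order
    [d^-(Re s)]; the step from [1] to [1 + d] costs [O(n d)].  The value
    [d = n^-(1 / (1 + Re s))] balances the two, and the inner sum is of order
    [n^(1 - 1 / (1 + Re s))], uniformly in [x]. *)
Lemma lhs_term_bound (s : C) :
  (0 < Re s)%R -> exists K, forall n y, (Cmod y <= 1)%R -> (Cmod (1 - y) <= 1)%R ->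
    (Cmod (lhs_term s y n) <= K * rpowneg (1 + / (1 + Re s)) (INR (S n)))%R.
Proof.
  intro Hs. destruct (fdiff_powneg_dominated s Hs) as [K [HK0 HK]].
  destruct (fdiff_powneg_dominated (s + 1)) as [K' [HK0' HK']]; [unfold Re in *; simpl; lra|].
  set (q := Re s) in *. replace (Re (s + 1)) with (q + 1)%R in HK' by reflexivity.
  assert (B : forall x n z, (Cmod (1 - x) <= 1)%R -> (0 < z)%R ->
     (Cmod (fdiff x n (powneg s) z) <= K * rpowneg q z)%R).
  { intros x n z Hx Hz. specialize (HK x n 0%nat z Hx Hz). simpl in HK.
    rewrite !Rmult_1_l, Rplus_0_r in HK. exact HK. }
  assert (B' : forall x n z, (Cmod (1 - x) <= 1)%R -> (0 < z)%R ->
     (Cmod (fdiff x n (powneg (s + 1)) z) <= K' * rpowneg (q + 1) z)%R).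
  { intros x n z Hx Hz. specialize (HK' x n 0%nat z Hx Hz). simpl in HK'.
    rewrite !Rmult_1_l, Rplus_0_r in HK'. exact HK'. }
  clear HK HK'.
  exists (Cmod s * K' + 1 + K)%R. intros n y Hy Hy1.
  set (e := (/ (1 + q))%R). assert (He : (0 < e)%R) by (apply Rinv_0_lt_compat; lra).
  assert (Hm := lt_0_INR (S n) ltac:(lia)). set (m := INR (S n)) in *.
  assert (Hm1 : (1 <= m)%R) by apply INR_S_ge_1.
  set (d := rpowneg e m). assert (Hd : (0 < d)%R) by apply rpowneg_pos.
  assert (Hmd : (m * d = rpowneg (e - 1) m)%R).
  { rewrite (rpowneg_succ (e - 1) m Hm). unfold d. do 2 f_equal. ring. }
  assert (Hdq : (rpowneg q d = rpowneg (e - 1) m)%R).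
  { unfold d. unfold rpowneg. rewrite ln_exp. f_equal.
    assert (E : (e * (1 + q) = 1)%R) by (unfold e; field; lra).
    replace (e - 1)%R with (- (e * q))%R by lra. ring. }
  set (S1 := fun z => sum_n (fun j => fdiff y j (powneg s) z) n).
  assert (HT : forall z, y * S1 (z + 1)%R = powneg s z - fdiff y (S n) (powneg s) z).
  { intro z. unfold S1. generalize n. intro k. induction k.
    - rewrite sum_O. simpl. ring.
    - rewrite sum_n_C_S, Cmult_plus_distr_l, IHk, (fdiff_S y (S k)). Cring. }
  assert (HD : (Cmod (S1 1%R - S1 (1 + d)%R) <= (Cmod s * (m * K')) * (1 + d - 1))%R).
  { apply (mean_value_bound _ (fun t => - s * sum_n (fun j => fdiff y j (powneg (s + 1)) t) n)); [lra| |].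
    - intros t Ht. rewrite <- sum_n_C_mult_l. apply derivC_sum_n.
      intro k. apply derivC_fdiff_powneg. lra.
    - intros t Ht. rewrite Cmod_mult, Cmod_opp. apply Rmult_le_compat_l; [apply Cmod_ge_0|].
      unfold m. rewrite <- sum_n_R_const. apply Cmod_sum_n_le. intro k.
      eapply Rle_trans; [apply B'; lra|].
      rewrite <- (Rmult_1_r K') at 2. apply Rmult_le_compat_l; [exact HK0'|].
      apply rpowneg_le_1; lra. }
  assert (HI : (Cmod (inner_sum s y (S n)) <= (Cmod s * K' + 1 + K) * rpowneg (e - 1) m)%R).
  { rewrite inner_sum_partial. fold (S1 1%R). rewrite Cmod_opp.
    replace (y * S1 1%R) with (y * (S1 1%R - S1 (1 + d)%R) + (powneg s d + - fdiff y (S n) (powneg s) d)).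
    2:{ assert (T := HT d). rewrite (Rplus_comm d 1) in T.
        replace (powneg s d + - fdiff y (S n) (powneg s) d) with (y * S1 (1 + d)%R) by (rewrite T; ring). ring. }
    eapply Rle_trans; [apply Cmod_triangle|].
    assert (T1 := Cmod_triangle (powneg s d) (- fdiff y (S n) (powneg s) d)).
    rewrite Cmod_opp, Cmod_powneg in T1. fold q in T1.
    specialize (B y (S n) d Hy1 Hd). rewrite Hdq in B, T1.
    rewrite Cmod_mult.
    assert (T2 : (Cmod y * Cmod (S1 1%R - S1 (1 + d)%R) <= 1 * (Cmod s * (m * K') * (1 + d - 1)))%R).
    { apply Rmult_le_compat; auto using Cmod_ge_0. }
    replace (1 * (Cmod s * (m * K') * (1 + d - 1)))%R with (Cmod s * K' * (m * d))%R in T2 by ring.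
    rewrite Hmd in T2. lra. }
  unfold lhs_term. fold m.
  assert (Hm0 : RtoC m <> 0) by apply INR_S_neq_0.
  rewrite Cmod_mult, Cmod_div, Cmod_1, Cmod_pow, Cmod_R, (Rabs_pos_eq m)
    by (first [now apply Cpow_nz | lra]).
  replace (1 + e)%R with ((e - 1) + 1 + 1)%R by ring.
  rewrite (rpowneg_succ (e - 1) m Hm), (rpowneg_succ (e - 1 + 1) m Hm) in HI.
  apply Rmult_le_reg_l with (m ^ 2)%R; [nra|].
  replace (m ^ 2 * (1 / m ^ 2 * Cmod (inner_sum s y (S n))))%R with (Cmod (inner_sum s y (S n)))
    by (field; lra).
  eapply Rle_trans; [exact HI|]. right. ring.
Qed.

Lemma Clim_fdiff (y : nat -> C) (x : C) (n : nat) (f : R -> C) (z : R) :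
  Clim y x -> Clim (fun i => fdiff (y i) n f z) (fdiff x n f z).
Proof.
  intro H. revert z. induction n; intro z; [exact (Clim_const (f z))|].
  rewrite fdiff_S.
  replace (fdiff x n f z - x * fdiff x n f (z + 1)%R) with
    (fdiff x n f z + - (1) * (x * fdiff x n f (z + 1)%R)) by ring.
  apply Clim_ext with (fun i => fdiff (y i) n f z + - (1) * (y i * fdiff (y i) n f (z + 1)%R)).
  { intro i. rewrite fdiff_S. ring. }
  apply Clim_plus; [apply IHn|]. apply Clim_scal. apply Clim_mult; [exact H | apply IHn].
Qed.

Lemma Clim_pow (y : nat -> C) (x : C) (n : nat) :
  Clim y x -> Clim (fun i => y i ^ n) (x ^ n).
Proof.
  intro H. induction n; [exact (Clim_const 1)|]. exact (Clim_mult _ _ _ _ H IHn).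
Qed.

Lemma Clim_polylog (s x : C) (y : nat -> C) :
  (1 < Re s)%R -> (forall i, (Cmod (y i) <= 1)%R) -> Clim y x ->
  Clim (fun i => polylog s (y i)) (polylog s x).
Proof.
  intros Hs Hy H.
  assert (Hg : ex_series (fun n => rpowneg (Re s) (INR (S n)))).
  { replace (Re s) with (1 + (Re s - 1))%R by ring. apply ex_series_rpowneg. lra. }
  assert (HB : forall w n, (Cmod w <= 1)%R ->
     (Cmod (w ^ S n * powneg s (INR (S n))) <= rpowneg (Re s) (INR (S n)))%R).
  { intros w n Hw. rewrite Cmod_mult, Cmod_pow, Cmod_powneg.
    rewrite <- (Rmult_1_l (rpowneg _ _)) at 2.
    apply Rmult_le_compat_r; [apply Rlt_le, rpowneg_pos|].
    rewrite <- (pow1 (S n)). apply pow_incr. split; [apply Cmod_ge_0 | exact Hw]. }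
  assert (Hx : (Cmod x <= 1)%R) by (exact (Clim_le _ _ _ Hy H)).
  destruct (tannery (fun i n => y i ^ S n * powneg s (INR (S n))) (fun n => x ^ S n * powneg s (INR (S n)))
    (fun i => polylog s (y i)) (fun n => rpowneg (Re s) (INR (S n)))) as [l [Hl HL]].
  - intros i n. now apply HB.
  - exact Hg.
  - intro i. apply polylog_series with (fun n => rpowneg (Re s) (INR (S n))); [|exact Hg].
    intro n. now apply HB.
  - intro n. apply Clim_mult; [now apply Clim_pow | apply Clim_const].
  - replace (polylog s x) with (l : C); [exact HL|].
    assert (T := polylog_series s x _ (fun n => HB x n Hx) Hg).
    apply Cseries_Clim in T. apply Cseries_Clim in Hl. exact (Clim_unique _ _ _ Hl T).
Qed.

Lemma Clog_scale (r : R) (x : C) :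
  (0 < r)%R -> x <> 0 -> Clog (RtoC r * x) = RtoC (ln r) + Clog x.
Proof.
  intros Hr Hx. assert (Hm : (0 < Cmod x)%R) by (now apply Cmod_gt_0).
  unfold Clog. rewrite Cmod_mult, Cmod_R, Rabs_pos_eq, ln_mult by lra.
  unfold Carg. rewrite re_scal_l, im_scal_l, Cmod_mult, Cmod_R, Rabs_pos_eq by lra.
  replace (r * Re x / (r * Cmod x))%R with (Re x / Cmod x)%R by (field; lra).
  unfold RtoC, Cplus; simpl. f_equal.
  destruct (Rle_dec 0 (r * Im x)) as [h|h], (Rle_dec 0 (Im x)) as [h'|h']; try ring; exfalso.
  - apply h'. nra.
  - apply h. nra.
Qed.

(** The hypothesis [|1 - x| <= 1] amounts to [|x|^2 <= 2 Re x], and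
    [|1 - r x|^2 = 1 - 2 r Re x + r^2 |x|^2]. *)
Lemma contract_open (r : R) (x : C) :
  (0 < r < 1)%R -> x <> 0 -> (Cmod x <= 1)%R -> (Cmod (1 - x) <= 1)%R ->
  (Cmod (RtoC r * x) < 1)%R /\ (Cmod (1 - RtoC r * x) < 1)%R.
Proof.
  intros Hr Hx H1 H2. assert (Hm : (0 < Cmod x)%R) by (now apply Cmod_gt_0).
  split.
  - rewrite Cmod_mult, Cmod_R, Rabs_pos_eq by lra. nra.
  - assert (E1 := Cmod2_alt x). assert (E2 := Cmod2_alt (1 - x)).
    assert (E3 := Cmod2_alt (1 - RtoC r * x)).
    replace (Re (1 - x)) with (1 - Re x)%R in E2 by (unfold Re, RtoC, Cminus, Cplus, Copp; simpl; ring).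
    replace (Im (1 - x)) with (- Im x)%R in E2 by (unfold Im, RtoC, Cminus, Cplus, Copp; simpl; ring).
    replace (Re (1 - RtoC r * x)) with (1 - r * Re x)%R in E3
      by (unfold Re, RtoC, Cminus, Cplus, Copp, Cmult; simpl; ring).
    replace (Im (1 - RtoC r * x)) with (- (r * Im x))%R in E3
      by (unfold Im, RtoC, Cminus, Cplus, Copp, Cmult; simpl; ring).
    assert (P2 := Cmod_ge_0 (1 - x)). assert (P3 := Cmod_ge_0 (1 - RtoC r * x)).
    assert (F2 : (Cmod (1 - x) ^ 2 <= 1)%R) by nra.
    assert (F1 : (Cmod x ^ 2 <= 2 * Re x)%R) by nra.
    assert (F4 : (0 < Cmod x ^ 2)%R) by (apply pow_lt; exact Hm).
    assert (F3 : (Cmod (1 - RtoC r * x) ^ 2 < 1)%R).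
    { rewrite E3. replace ((1 - r * Re x) ^ 2 + (- (r * Im x)) ^ 2)%R
        with (1 - r * (2 * Re x) + r ^ 2 * Cmod x ^ 2)%R by (rewrite E1; ring).
      assert (r * Cmod x ^ 2 <= r * (2 * Re x))%R by (apply Rmult_le_compat_l; lra).
      assert (r ^ 2 * Cmod x ^ 2 < r * Cmod x ^ 2)%R by (apply Rmult_lt_compat_r; nra).
      lra. }
    nra.
Qed.

Lemma identity_boundary (s x : C) :
  (0 < Re s)%R -> x <> 0 -> (Cmod x <= 1)%R -> (Cmod (1 - x) <= 1)%R ->
  Cseries (lhs_term s x) (rhs s x).
Proof.
  intros Hs Hx0 Hx1 Hx.
  set (r := fun i : nat => (1 - / INR (S (S i)))%R).
  assert (Hr : forall i, (0 < r i < 1)%R).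
  { intro i. unfold r. assert (T := pos_INR i). rewrite !S_INR.
    assert (H1 := Rinv_0_lt_compat (INR i + 1 + 1) ltac:(lra)).
    assert (H2 : (/ (INR i + 1 + 1) < / 1)%R) by (apply Rinv_lt_contravar; lra). lra. }
  assert (Hlim : is_lim_seq r 1%R).
  { replace (Finite 1) with (Finite (1 - 0)) by (f_equal; ring).
    apply is_lim_seq_minus'; [apply is_lim_seq_const | apply is_lim_seq_inv_SS]. }
  set (y := fun i => RtoC (r i) * x).
  assert (Hy : forall i, (Cmod (y i) < 1)%R /\ (Cmod (1 - y i) < 1)%R).
  { intro i. now apply contract_open. }
  assert (Hyx : Clim y x).
  { apply Clim_squeeze with (fun i => / INR (S (S i)) * Cmod x)%R.
    - intro i. unfold y. replace (RtoC (r i) * x - x) with (- (RtoC (/ INR (S (S i))) * x))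
        by (unfold r; rewrite RtoC_minus; ring).
      rewrite Cmod_opp, Cmod_mult, Cmod_R, Rabs_pos_eq; [apply Rle_refl|].
      apply Rlt_le, Rinv_0_lt_compat, lt_0_INR. lia.
    - replace 0%R with (0 * Cmod x)%R by ring.
      apply is_lim_seq_mult'; [apply is_lim_seq_inv_SS | apply is_lim_seq_const]. }
  destruct (lhs_term_bound s Hs) as [K HK].
  destruct (tannery (fun i n => lhs_term s (y i) n) (lhs_term s x) (fun i => rhs s (y i))
    (fun n => K * rpowneg (1 + / (1 + Re s)) (INR (S n)))%R) as [l [Hl HL]].
  - intros i n. destruct (Hy i). apply HK; lra.
  - apply (ex_series_scal (V := R_NormedModule) K (fun n => rpowneg (1 + / (1 + Re s)) (INR (S n)))).
    apply ex_series_rpowneg. apply Rinv_0_lt_compat. lra.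
  - intro i. destruct (Hy i). now apply identity_open.
  - intro n. unfold lhs_term. apply Clim_scal.
    apply Clim_ext with (fun i => fdiff (y i) (S n) (fun z => RtoC z * powneg (s + 1) z) 0).
    { intro i. now rewrite inner_sum_fdiff. }
    rewrite inner_sum_fdiff. now apply Clim_fdiff.
  - replace (rhs s x) with (l : C); [exact Hl|].
    apply (Clim_unique _ _ _ HL).
    assert (Hy1 : forall i, (Cmod (y i) <= 1)%R) by (intro i; destruct (Hy i); lra).
    unfold rhs. apply Clim_plus.
    + apply Clim_scal. apply Clim_polylog; auto. unfold Re in *; simpl; lra.
    + apply Clim_mult; [|apply Clim_polylog; auto; unfold Re in *; simpl; lra].
      apply Clim_ext with (fun i => RtoC (ln (r i)) + Clog x).
      { intro i. unfold y. symmetry. apply Clog_scale; [apply Hr | exact Hx0]. }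
      apply Clim_squeeze with (fun i => Rabs (ln (r i))).
      * intro i. replace (RtoC (ln (r i)) + Clog x - Clog x) with (RtoC (ln (r i))) by ring.
        rewrite Cmod_R. apply Rle_refl.
      * replace (Finite 0) with (Rbar_abs (Finite (ln 1))) by (simpl; rewrite ln_1, Rabs_R0; reflexivity).
        apply is_lim_seq_abs. apply is_lim_seq_continuous; [|exact Hlim].
        apply continuity_pt_filterlim. apply (ex_derive_continuous (V := R_NormedModule)).
        auto_derive. lra.
Qed.

Theorem theorem4p4 (s x : C)
  (hx : ((Cmod x < 1)%R /\ (Cmod (1 - x) < 1)%R) \/
        ((0 < Re s)%R /\ x <> 0 /\ (Cmod x <= 1)%R /\ (Cmod (1 - x) <= 1)%R)) :
  @is_series C_AbsRing C_NormedModule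
    (fun n : nat => 1 / RtoC (INR (S n)) ^ 2 * inner_sum s x (S n))
    (- (s + 1) * polylog (s + 2) x + Clog x * polylog (s + 1) x).
Proof.
  destruct hx as [[H1 H2] | (Hs & H0 & H1 & H2)].
  - exact (identity_open x H1 H2 s).
  - exact (identity_boundary s x Hs H0 H1 H2).
Qed.
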